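(* Assume $p \gtrsim n$ and that $\mathbb{X}=[X_1,\dots,X_n]\in\mathbb{R}^{p\times n}$ has i.i.d. zero mean and unit variance entries, satisfies the weak moment assumption with $\zeta \geq 1/2$ and the anti-concentration assumption with $\alpha \in (0,1]$. Let $y_1,\dots,y_n$ be generated from $\beta^*\in\mathcal{S}^{p-1}$ and the flipped index set $\mathcal{O}\subset[n]$ as described in the context. Let $\tilde \beta$ be an approximation of the max $\ell_1$-margin and suppose that with probability at least $1-t$ the max $\ell_1$-margin $\gamma$ satisfies $\gamma \geq \gamma_0$, where $\gamma_0>0$. Define $$\eta = \left( \frac{\log^{2\zeta+1}(p)\log(n)}{\gamma_0^2\, n} \right)^{\frac{1}{2+\alpha}},$$ and assume that $\eta \lesssim 1$ and $|\mathcal{O}| \lesssim \eta^{\alpha} n$. Then with probability at least $1-cp^{-1}-t$ we have $$d(\tilde\beta,\beta^* ) \lesssim \eta^{\alpha}.$$ Moreover, if $\mathbb{X}$ satisfies the small deviation assumption with $\theta>0$ and $|\mathcal{O}| \lesssim \eta^{\alpha(1+\frac{2}{\theta})} n$, then with probability at least $1-cp^{-1}-t$ we have $$d(\tilde\beta,\beta^* ) \lesssim \eta^{\alpha\left(1+\frac{2}{\theta}\right)}.$$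
   Context: Model. One observes $(y_i,X_i)_{i\in[n]}$, where $X_1,\dots,X_n$ are i.i.d. copies of a random vector $X=(x_1,\dots,x_p)\in\mathbb{R}^p$ and $X_i$ is the $i$-th column of $\mathbb{X}$. For $\beta^*\in\mathcal{S}^{p-1}$ (the Euclidean unit sphere of $\mathbb{R}^p$) with $\|\beta^*\|_1\le\sqrt{s}$, and a set $\mathcal{O}\subset[n]=\{1,\dots,n\}$, $y_i=\mathrm{sgn}(\langle X_i,\beta^*\rangle)$ if $i\notin\mathcal{O}$ and $y_i=-\mathrm{sgn}(\langle X_i,\beta^*\rangle)$ if $i\in\mathcal{O}$, where $\mathrm{sgn}(x)=\mathbf{1}(x>0)-\mathbf{1}(x<0)$. The set $\mathcal{O}$ may be random and may depend adversarially on all features; $|\mathcal{O}|=o(n)$. Max $\ell_1$-margin: $\gamma := \max_{\beta\neq 0}\min_{1\le i\le n} \frac{y_i\langle X_i,\beta\rangle}{\|\beta\|_1}$. A (data-dependent) vector $\tilde\beta\in\mathbb{R}^p$ is an approximation of the max $\ell_1$-margin if $\min_{1\le i\le n} \frac{y_i\langle X_i,\tilde\beta\rangle}{\|\tilde\beta\|_1}\ge \frac{\gamma}{2}$. Prediction error: $d(\tilde\beta,\beta^* ) := \mathbb{P}\left(\mathrm{sgn}(\langle X_{n+1},\tilde\beta\rangle)\neq \mathrm{sgn}(\langle X_{n+1},\beta^*\rangle)\mid (y_i,X_i)_{i\in[n]}\right)$, with $X_{n+1}$ an independent copy of $X$. Weak moment assumption with $\zeta\ge 1/2$: every entry $x$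 is centered and $(\mathbb{E}|x|^q)^{1/q}\lesssim q^{\zeta}$ for all $1\le q\le \max(1,\log p)$. Anti-concentration assumption with $\alpha\in(0,1]$: $\sup_{\beta\in\mathcal{S}^{p-1}}\mathbb{P}(|\langle X,\beta\rangle|\le\varepsilon)\lesssim\varepsilon^{\alpha}$ for all $p^{-1}\le\varepsilon\le1$. Small deviation assumption with $\theta>0$: $\inf_{\beta\in\mathcal{S}^{p-1}}\mathbb{P}(|\langle X,\beta\rangle|\le\varepsilon)\gtrsim\varepsilon^{\theta}$ for all $p^{-1}\le\varepsilon\le1$. Conventions. $a\lesssim b$ (equivalently $b\gtrsim a$) means $a\le Cb$ with a constant $C>0$ depending only on the fixed parameters ($\zeta,\alpha,\theta$ and the implicit constants in the three assumptions above), not on $n,p,s,|\mathcal{O}|$. In a hypothesis on $n,p,\eta,|\mathcal{O}|$, $a\lesssim b$ means $a\le cb$ for a sufficiently small such constant $c>0$ (so $p\gtrsim n$ means $p\ge Cn$ for a sufficiently large constant $C$). $c$ denotes a generic positive constant of this kind. *)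

(* Defs.v *)
From HB Require Import structures.
From mathcomp Require Import all_boot all_order all_algebra.
From mathcomp Require Import all_classical all_reals all_analysis.

Set Implicit Arguments.
Unset Strict Implicit.
Unset Printing Implicit Defensive.
Import Order.TTheory GRing.Theory Num.Theory.
Import numFieldNormedType.Exports.

Local Open Scope classical_set_scope.
Local Open Scope ring_scope.

(* Vectors of R^p are p-tuples, which carry the product sigma-algebra. *)
Section vectors.
Context {R : realType} {p : nat}.
Implicit Types x b : p.-tuple R.

Definition vec0 : p.-tuple R := [tuple 0 | j < p].
Definition dotp x b : R := \sum_(j < p) tnth x j * tnth b j.
Definition l1norm b : R := \sum_(j < p) `|tnth b j|.
Definition l2norm b : R := Num.sqrt (\sum_(j < p) tnth b j ^+ 2).
Definition unit_sphere : set (p.-tuple R) := [set b | l2norm b = 1].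

End vectors.
Arguments vec0 {R p}.
Arguments unit_sphere {R p}.

Section margin.
Context {R : realType} {n p : nat}.
(* A sample z lists the pairs (y_i, X_i). *)
Implicit Types (z : n.-tuple (R * p.-tuple R)) (b : p.-tuple R).

(* For n > 0, the infimum is a minimum. *)
Definition l1_margin z b : R :=
  inf (range (fun i : 'I_n =>
    (tnth z i).1 * dotp (tnth z i).2 b / l1norm b)).

(* For n, p > 0, the supremum is attained, as l1_margin z is continuous and
   homogeneous of degree 0 on the nonzero vectors. *)
Definition max_l1_margin z : R :=
  sup [set l1_margin z b | b in [set b | b != vec0]].

Definition approx_max_l1_margin z b : Prop :=
  b != vec0 /\ max_l1_margin z / 2 <= l1_margin z b.

End margin.

Section probability_notions.
Context {R : realType} {d : measure_display} {T : measurableType d}.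
Variable P : probability T R.

(* "With probability at least q, A holds"; the inner event E makes this
   meaningful before A is known to be measurable, and for a measurable A it is
   q%:E <= P A. *)
Definition with_prob_ge (q : R) (A : set T) : Prop :=
  exists E : set T, [/\ measurable E, E `<=` A & (q%:E <= P E)%E].

Definition mutually_independent (I : finType) (Z : I -> T -> R) : Prop :=
  forall (S : {set I}) (A : I -> set R), (forall i, measurable (A i)) ->
    P (\bigcap_(i in [set` S]) (Z i @^-1` A i)) =
    (\big[*%E/1%E]_(i in S) P (Z i @^-1` A i))%E.

Definition identically_distributed d' (U : measurableType d') (Y Z : T -> U) :
    Prop :=
  forall A : set U, measurable A -> P (Y @^-1` A) = P (Z @^-1` A).

Definition independent_rv d1 d2
    (U1 : measurableType d1) (U2 : measurableType d2)
    (Y : T -> U1) (Z : T -> U2) : Prop :=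
  forall (A : set U1) (B : set U2), measurable A -> measurable B ->
    P (Y @^-1` A `&` Z @^-1` B) = (P (Y @^-1` A) * P (Z @^-1` B))%E.

(* D is a version of the conditional probability P(A | Z). *)
Definition cond_prob_version d' (U : measurableType d') (Z : T -> U)
    (A : set T) (D : T -> R) : Prop :=
  let sigmaZ := preimage_set_system [set: T] Z measurable in
  [/\ forall B : set R, measurable B -> sigmaZ (D @^-1` B),
      P.-integrable [set: T] (EFin \o D)
    & forall G, sigmaZ G -> (\int[P]_(w in G) (D w)%:E)%E = P (A `&` G)].

End probability_notions.

Section feature_assumptions.
Context {R : realType} {d : measure_display} {T : measurableType d}.
Context (P : probability T R) {p : nat}.
Implicit Type x : T -> p.-tuple R.

Definition weak_moment (K zeta : R) x : Prop :=
  forall j : 'I_p,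
    ('E_P[fun w => tnth (x w) j] = 0)%E /\
    forall q : R, 1 <= q <= Num.max 1 (ln p%:R) ->
      (Lnorm P q%:E (fun w => (tnth (x w) j)%:E) <= (K * q `^ zeta)%:E)%E.

Definition anti_concentration (K alpha : R) x : Prop :=
  forall eps : R, p%:R^-1 <= eps <= 1 ->
    (ereal_sup [set P [set w | (`|dotp (x w) b| <= eps)%R] | b in unit_sphere]
      <= (K * eps `^ alpha)%:E)%E.

Definition small_deviation (K theta : R) x : Prop :=
  forall eps : R, p%:R^-1 <= eps <= 1 ->
    ((K * eps `^ theta)%:E
      <= ereal_inf
           [set P [set w | (`|dotp (x w) b| <= eps)%R] | b in unit_sphere])%E.

End feature_assumptions.

Section one_bit.
Context {R : realType} {d : measure_display} {T : measurableType d}.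
Context (P : probability T R) {n p : nat}.
Implicit Types (X : 'I_n -> {RV P >-> p.-tuple R}).
Implicit Types (Xnew : {RV P >-> p.-tuple R}).
Implicit Types (O : T -> {set 'I_n}) (bstar : p.-tuple R).

Definition obs_label X O bstar (i : 'I_n) (w : T) : R :=
  if i \in O w then - Num.sg (dotp (X i w) bstar)
  else Num.sg (dotp (X i w) bstar).

Definition obs_sample X O bstar (w : T) : n.-tuple (R * p.-tuple R) :=
  [tuple (obs_label X O bstar i w, X i w) | i < n].

(* The flipped set O may depend on the features, and on any further
   randomness for which Xnew stays independent of the sample. *)
Record one_bit_model (s : R) bstar X O Xnew : Prop := OneBitModel {
  bstar_sphere : unit_sphere bstar;
  bstar_l1 : l1norm bstar <= Num.sqrt s;
  flips_measurable : forall i, measurable [set w | i \in O w];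
  entries_independent : mutually_independent P
    (fun (ij : 'I_n * 'I_p) w => tnth (X ij.1 w) ij.2);
  entries_identical : forall i j i' j', identically_distributed P
    (fun w => tnth (X i w) j) (fun w => tnth (X i' w) j');
  entries_mean : forall i j, ('E_P[fun w => tnth (X i w) j] = 0)%E;
  entries_variance : forall i j, ('V_P[fun w => tnth (X i w) j] = 1)%E;
  Xnew_copy : forall i, identically_distributed P Xnew (X i);
  Xnew_independent : independent_rv P Xnew (obs_sample X O bstar) }.

(* D is (a version of) the prediction error d(btilde, bstar), for an
   estimator btilde that is a function of the sample. *)
Definition prediction_error X O bstar Xnew
    (btilde : n.-tuple (R * p.-tuple R) -> p.-tuple R) (D : T -> R) : Prop :=
  cond_prob_version P (obs_sample X O bstar)
    [set w | Num.sg (dotp (Xnew w) (btilde (obs_sample X O bstar w)))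
             != Num.sg (dotp (Xnew w) bstar)] D.

End one_bit.

Definition eta_rate {R : realType} (zeta alpha gamma0 : R) (n p : nat) : R :=
  (ln p%:R `^ (2 * zeta + 1) * ln n%:R / (gamma0 ^+ 2 * n%:R))
    `^ (1 / (2 + alpha)).

(* Main.v *)
Require Import Defs.
From HB Require Import structures.
From mathcomp Require Import all_boot all_order all_algebra.
From mathcomp Require Import all_classical all_reals all_analysis.
From mathcomp Require Import measurable_realfun.
From mathcomp Require Import ring lra.

Set Implicit Arguments.
Unset Strict Implicit.
Unset Printing Implicit Defensive.
Import Order.TTheory GRing.Theory Num.Theory.
Import numFieldNormedType.Exports.

Local Open Scope classical_set_scope.
Local Open Scope ring_scope.

(** Write rate := log(p)^(2 zeta + 1) log(n) / (gamma0^2 n), which is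
    eta^(2 + alpha).  As eta <= 1, each part follows from one statement
    ([margin_generalization]): for every rho >= rate, if at most a constant
    times rho n labels are flipped, then the prediction error is at most a
    constant times rho.  It is applied to rho = eta^e, which requires
    e <= 2 + alpha.  For e = alpha this is clear, and for
    e = alpha (1 + 2/theta) it says alpha <= theta.  Conversely, the
    anti-concentration and small deviation bounds at the level 1/p give
    Ks p^-theta <= Ka p^-alpha, so theta < alpha forces p to be bounded
    ([small_deviation_dimension]); the constant in p >= C0 n excludes that.

    The bound on the error is a margin argument by compression.  Normalize the
    estimator to a vector b of unit l1-norm.  All the sample points satisfy
    y_i <X_i, b> >= gamma0/2, and with probability 1 - 1/p all the features
    are at most M ~ log(p)^zeta (Markov's inequality for the moment of order
    log p, [Lnorm_tail]).  Hence gamma0 <= 2M unless the claim is void.  By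
    Maurey's method ([maurey_approximation]) some average b' of
    m ~ M^2 log(n) / gamma0^2 signed basis vectors satisfies
    |<x, b> - <x, b'>| <= gamma0/5 at all the sample points and, with
    probability 1 - O(1/n), at a fresh point.  Let B(b') be the set of the x
    with sgn<x, bstar> <x, b'> <= gamma0/5.

    - Off the flipped indices, no sample point lies in B(b'), because its
      margin is at least gamma0/2 - gamma0/5.  There are at most (2p)^m vectors b', and
      m log p ~ rate n, so a Chernoff bound and a union bound
      ([uniform_hits_lower_tail]) show that, with probability 1 - 1/p, every b'
      such that B(b') is hit at most O(rho n) times has P(B(b')) = O(rho).
    - If b and bstar disagree in sign at a fresh x, then x lies in B(b') or
      |<x, b> - <x, b'>| > gamma0/5 ([sign_disagreement]).  Both events have
      probability O(rho), as 1/n = O(rate).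

    Three facts of measure theory connect this with the model: independence of
    the entries gives independence of the columns for general measurable sets
    ([columns_independent]), the conditional probability of an event about
    (sample, fresh point) is the measure of a section of that event
    ([cond_prob_version_le_section]), and the choice of b' does not have to be
    measurable, because it is only used to bound this measure pointwise. *)

(** * Deviation of sample means under a finite distribution *)

Section finite_sampling.
Context {R : realType}.

Lemma expR_le_quadratic (y : R) : y <= 2^-1 -> expR y <= 1 + y + 2 * y ^+ 2.
Proof.
move=> y2; have y1 : 0 < 1 - y by lra.
have e1 : 1 - y <= expR (- y) by have := expR_ge1Dx (- y).
apply: (@le_trans _ _ ((1 - y)^-1)).
  by rewrite -[expR y]invrK -expRN lef_pV2 ?posrE ?expR_gt0.
rewrite -[leLHS]mul1r ler_pdivrMr//.
have : 0 <= y ^+ 2 * (1 - 2 * y) by rewrite mulr_ge0 ?sqr_ge0//; lra.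
rewrite -(lerDl 1) => /le_trans; apply.
by rewrite le_eqVlt; apply/orP; left; apply/eqP; ring.
Qed.

Lemma sum_prod_weights (V : finType) (m : nat) (w : V -> R) :
  \sum_v w v = 1 -> \sum_(k : {ffun 'I_m -> V}) \prod_(l < m) w (k l) = 1.
Proof.
move=> w1; rewrite -(bigA_distr_bigA (fun (_ : 'I_m) v => w v)).
by rewrite big1.
Qed.

Lemma finite_mgf_le (V : finType) (w f : V -> R) (M lam : R) :
  (forall v, 0 <= w v) -> \sum_v w v = 1 -> (forall v, `|f v| <= M) ->
  0 <= lam -> lam * (2 * M) <= 2^-1 ->
  \sum_v w v * expR (lam * (f v - \sum_u w u * f u)) <= expR (8 * (lam * M) ^+ 2).
Proof.
move=> w0 w1 fM lam0 lamM; set mu := \sum_u w u * f u.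
have muM : `|mu| <= M.
  rewrite -[leRHS]mul1r -w1 mulr_suml; apply: le_trans (ler_norm_sum _ _ _) _.
  apply: ler_sum => v _; rewrite normrM (ger0_norm (w0 v)).
  exact: ler_wpM2l.
have M0 : 0 <= M by apply: le_trans muM; exact: normr_ge0.
apply: (@le_trans _ _ (\sum_v w v * (1 + lam * (f v - mu) + 8 * (lam * M) ^+ 2))).
  apply: ler_sum => v _; apply: ler_wpM2l => //.
  have fmu : `|f v - mu| <= 2 * M.
    by rewrite (le_trans (ler_normB _ _))// (_ : 2 * M = M + M) ?lerD//; ring.
  apply: le_trans (expR_le_quadratic _) _.
    apply: le_trans lamM; rewrite ler_wpM2l// (le_trans _ fmu)//.
    exact: ler_norm.
  rewrite lerD2l.
  have -> : 8 * (lam * M) ^+ 2 = 2 * (lam * (2 * M)) ^+ 2 by ring.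
  rewrite ler_wpM2l// -[leLHS]real_normK ?num_real// ler_pXn2r ?nnegrE ?mulr_ge0//.
  by rewrite normrM (ger0_norm lam0) ler_wpM2l.
apply: le_trans (expR_ge1Dx _).
under eq_bigr do rewrite mulrDr mulrDr mulr1 mulrCA mulrBr.
rewrite !big_split/= w1 -mulr_suml w1 mul1r -mulr_sumr big_split/=.
by rewrite sumrN -mulr_suml w1 mul1r subrr mulr0 addr0.
Qed.

(** Chernoff's method for the mean of m independent draws, with expectations
    written as sums over all the outcomes k.  The condition t <= 4 M keeps the
    exponents at most 1/2, where the quadratic bound on expR holds. *)
Lemma sample_mean_tail (V : finType) (m : nat) (w f : V -> R) (M t : R) :
  (0 < m)%N -> (forall v, 0 <= w v) -> \sum_v w v = 1 ->
  (forall v, `|f v| <= M) -> 0 < M -> 0 <= t -> t <= 4 * M ->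
  \sum_(k : {ffun 'I_m -> V}) (\prod_(l < m) w (k l)) *
     (t < m%:R^-1 * (\sum_(l < m) f (k l)) - \sum_u w u * f u)%R%:R
  <= expR (- (m%:R * t ^+ 2 / (32 * M ^+ 2))).
Proof.
move=> m0 w0 w1 fM M0 t0 tM; set mu := \sum_u w u * f u.
have mR : 0 < m%:R :> R by rewrite ltr0n.
(* minimizes 8 lam^2 M^2 - lam t *)
pose lam := t / (16 * M ^+ 2).
have MN : M != 0 by rewrite gt_eqF.
have lam0 : 0 <= lam by rewrite divr_ge0// mulr_ge0// sqr_ge0.
have lamM : lam * (2 * M) <= 2^-1.
  have -> : lam * (2 * M) = t / (8 * M) by rewrite /lam; field.
  by rewrite ler_pdivrMr ?mulr_gt0//; lra.
apply: (@le_trans _ _ (\sum_(k : {ffun 'I_m -> V})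
   (\prod_(l < m) (w (k l) * expR (lam * (f (k l) - mu)))) *
   expR (- (lam * (m%:R * t))))).
  apply: ler_sum => k _; rewrite big_split/= -mulrA ler_wpM2l ?prodr_ge0//.
  rewrite -expR_sum -expRD.
  case: ltP => [tl|_]; last exact: expR_ge0.
  rewrite -[leLHS]expR0 ler_expR -mulr_sumr -mulrBr mulr_ge0// subr_ge0.
  have -> : \sum_(l < m) (f (k l) - mu) =
            m%:R * (m%:R^-1 * (\sum_(l < m) f (k l)) - mu).
    rewrite sumrB sumr_const card_ord mulrBr mulrA mulfV ?gt_eqF// mul1r.
    by rewrite mulr_natl.
  by rewrite ler_pM2l// ltW.
rewrite -mulr_suml -(bigA_distr_bigA (fun (_ : 'I_m) v =>
  w v * expR (lam * (f v - mu)))) prodr_const card_ord.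
have := finite_mgf_le w0 w1 fM lam0 lamM; rewrite -/mu => mgf.
apply: (@le_trans _ _ (expR (8 * (lam * M) ^+ 2) ^+ m * expR (- (lam * (m%:R * t))))).
  rewrite ler_wpM2r ?expR_ge0//; apply: lerXn2r; rewrite ?nnegrE ?expR_ge0//.
  by apply: sumr_ge0 => v _; rewrite mulr_ge0 ?expR_ge0.
rewrite -expRM_natl -expRD ler_expR /lam.
rewrite le_eqVlt; apply/orP; left; apply/eqP; by field.
Qed.

End finite_sampling.

(** * Maurey averages of signed basis vectors *)

Section maurey.
Context {R : realType}.

Definition signed_basis_average p m (k : {ffun 'I_m -> 'I_p * bool}) :
    p.-tuple R :=
  [tuple m%:R^-1 * \sum_(l < m) (-1) ^+ (k l).2 * ((k l).1 == j)%:R | j < p].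

(** The law of the signed basis vector e_j or - e_j (the boolean is the sign)
    whose mean is b, for b of unit l1-norm. *)
Definition maurey_weight p (b : p.-tuple R) (v : 'I_p * bool) : R :=
  Num.max 0 ((-1) ^+ v.2 * tnth b v.1).

Lemma dotp_signed_basis_average p m (k : {ffun 'I_m -> 'I_p * bool})
    (x : p.-tuple R) :
  dotp x (signed_basis_average k) =
  m%:R^-1 * \sum_(l < m) (-1) ^+ (k l).2 * tnth x (k l).1.
Proof.
rewrite /dotp; under eq_bigr do rewrite tnth_mktuple mulrCA.
rewrite -mulr_sumr; congr (_ * _).
under eq_bigr do rewrite mulr_sumr.
rewrite exchange_big; apply: eq_bigr => l _ /=.
rewrite (bigD1 (k l).1)//= eqxx mulr1 big1 ?addr0 1?mulrC// => j jk.
by rewrite eq_sym (negbTE jk) !mulr0.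
Qed.

Lemma sum_signed_basis p (G : 'I_p * bool -> R) :
  \sum_v G v = \sum_(j < p) (G (j, true) + G (j, false)).
Proof.
rewrite (eq_bigr (fun v => G (v.1, v.2))); last by case.
rewrite -(pair_bigA _ (fun j b => G (j, b)))/=.
by apply: eq_bigr => j _; rewrite big_bool.
Qed.

Lemma sum_maurey_weight p (b : p.-tuple R) :
  \sum_v maurey_weight b v = l1norm b.
Proof.
rewrite sum_signed_basis; apply: eq_bigr => j _; rewrite /maurey_weight/=.
rewrite expr1 expr0 mul1r mulN1r.
have /orP[h|h] := le_total 0 (tnth b j).
  by rewrite max_l ?oppr_le0// max_r// add0r ger0_norm.
by rewrite max_r ?oppr_ge0// max_l// addr0 ler0_norm.
Qed.

Lemma mean_maurey_weight p (b x : p.-tuple R) :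
  \sum_v maurey_weight b v * ((-1) ^+ v.2 * tnth x v.1) = dotp x b.
Proof.
rewrite sum_signed_basis; apply: eq_bigr => j _; rewrite /maurey_weight/=.
rewrite expr1 expr0 !mul1r !mulN1r mulrN -mulNr -mulrDl mulrC.
congr (_ * _); have /orP[h|h] := le_total 0 (tnth b j).
  by rewrite max_l ?oppr_le0// max_r// oppr0 add0r.
by rewrite max_r ?oppr_ge0// max_l// opprK addr0.
Qed.

(** For fixed x, [dotp x (signed_basis_average k)] is a sample mean of m
    independent entries of x up to sign, each with expectation [dotp x b]. *)
Lemma maurey_deviation p m (b x : p.-tuple R) (M t : R) :
  (0 < m)%N -> l1norm b = 1 -> (forall j, `|tnth x j| <= M) ->
  0 < M -> 0 <= t -> t <= 4 * M ->
  \sum_(k : {ffun 'I_m -> 'I_p * bool}) (\prod_(l < m) maurey_weight b (k l)) *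
     (t < `|dotp x b - dotp x (signed_basis_average k)|)%R%:R
  <= 2 * expR (- (m%:R * t ^+ 2 / (32 * M ^+ 2))).
Proof.
move=> m0 b1 xM M0 t0 tM; set e := expR _.
have w0 v : 0 <= maurey_weight b v by rewrite le_max lexx.
have w1 : \sum_v maurey_weight b v = 1 by rewrite sum_maurey_weight.
pose f (v : 'I_p * bool) := (-1) ^+ v.2 * tnth x v.1.
have fM v : `|f v| <= M by rewrite normrM normr_sign mul1r.
have fMN v : `|- f v| <= M by rewrite normrN.
have := sample_mean_tail m0 w0 w1 fM M0 t0 tM.
have := sample_mean_tail m0 w0 w1 fMN M0 t0 tM.
rewrite -/e => h2 h1; rewrite mulrDl mul1r; apply: le_trans (lerD h1 h2).
rewrite -big_split/=; apply: ler_sum => k _; rewrite -mulrDr ler_wpM2l//.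
  by rewrite prodr_ge0.
have -> : \sum_v maurey_weight b v * - f v = - dotp x b.
  by rewrite -mean_maurey_weight -sumrN; apply: eq_bigr => v _; rewrite mulrN.
rewrite mean_maurey_weight sumrN mulrN opprK -dotp_signed_basis_average.
rewrite distrC lter_normr opprB [X in _ || (_ < X)]addrC.
by case: (_ < _); case: (_ < _); rewrite /= ?addr0 ?add0r// -natrD ler_nat.
Qed.

End maurey.

(** * From independent entries to independent columns *)

Section tuple_rectangles.
Context {R : realType} {p : nat}.

Definition tuple_rect (A : 'I_p -> set R) : set (p.-tuple R) :=
  [set x | forall j, A j (tnth x j)].

Lemma measurable_tuple_rect (A : 'I_p -> set R) :
  (forall j, measurable (A j)) -> measurable (tuple_rect A).
Proof.
move=> mA.
have -> : tuple_rect A = \bigcap_(j in [set: 'I_p]) ((@tnth p R)^~ j @^-1` A j).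
  by apply/seteqP; split => x /= h; [move=> j _; exact: h|move=> j; exact: h].
apply: fin_bigcap_measurable => [|j _]; first exact: finite_finset.
by rewrite -[X in measurable X]setTI; exact: measurable_tnth.
Qed.

Lemma measurable_tuple_generated :
  (measurable : set (set (p.-tuple R))) =
  <<s [set C | exists A : 'I_p -> set R,
       (forall j, measurable (A j)) /\ C = tuple_rect A] >>.
Proof.
apply/seteqP; split; last first.
  apply: smallest_sub; first exact: sigma_algebra_measurable.
  by move=> _ [A [mA ->]]; exact: measurable_tuple_rect.
apply: smallest_sub; first exact: smallest_sigma_algebra.
move=> C; rewrite -bigcup_seq/= => -[j _ [B mB <-]].
apply: sub_sigma_algebra; exists (fun i => if i == j then B else setT); split.
  by move=> i; case: ifP.
rewrite setTI; apply/seteqP; split => x /=; last by move=> /(_ j); rewrite eqxx.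
by move=> Bx i; case: eqVneq => // ->.
Qed.

Lemma setI_closed_tuple_rect :
  setI_closed [set C | exists A : 'I_p -> set R,
       (forall j, measurable (A j)) /\ C = tuple_rect A].
Proof.
move=> _ _ [A [mA ->]] [B [mB ->]]; exists (fun j => A j `&` B j); split.
  by move=> j; exact: measurableI.
by apply/seteqP; split => x /=; [case=> a b j; split|move=> h; split => j; case: (h j)].
Qed.

Context {d : measure_display} {T : measurableType d} (P : probability T R).

(** Both sides are finite measures in C, and rectangles form a pi-system that
    generates the product sigma-algebra. *)
Lemma extend_product_rule (E : set T) (Y : {RV P >-> p.-tuple R}) (c : R) :
  measurable E -> 0 <= c ->
  (forall A : 'I_p -> set R, (forall j, measurable (A j)) ->
     P (E `&` Y @^-1` tuple_rect A) = (c%:E * P (Y @^-1` tuple_rect A))%E) ->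
  forall C, measurable C -> P (E `&` Y @^-1` C) = (c%:E * P (Y @^-1` C))%E.
Proof.
move=> mE c0 rule C mC.
pose m1 := pushforward (mrestr P mE) Y.
pose m2 := mscale (NngNum c0) (distribution P Y).
have : m1 C = m2 C.
  apply: (measure_unique _ (fun=> setT) measurable_tuple_generated
            setI_closed_tuple_rect) => //.
  - move=> _; exists (fun=> setT); split => //.
    by apply/seteqP; split.
  - by rewrite bigcup_const//; exists 0%N.
  - move=> _ [A [mA ->]]; rewrite /m1 /m2/= /pushforward /mrestr /mscale/=.
    by rewrite setIC rule.
  - move=> _; rewrite /m1/= /pushforward /mrestr preimage_setT setTI.
    by rewrite (le_lt_trans (probability_le1 P mE))// ltry.
by rewrite /m1 /m2/= /pushforward /mrestr /mscale/= setIC.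
Qed.

End tuple_rectangles.

Section column_independence.
Context {R : realType} {d : measure_display} {T : measurableType d}.
Context (P : probability T R) {n p : nat}.
Variable X : 'I_n -> {RV P >-> p.-tuple R}.

Hypothesis entries_indep : mutually_independent P
  (fun (ij : 'I_n * 'I_p) w => tnth (X ij.1 w) ij.2).

Lemma rect_columns_independent (A : 'I_n -> 'I_p -> set R) :
  (forall i j, measurable (A i j)) ->
  P (\bigcap_(i in [set: 'I_n]) (X i @^-1` tuple_rect (A i))) =
  (\big[*%E/1%E]_(i < n) P (X i @^-1` tuple_rect (A i)))%E.
Proof.
move=> mA; pose A' (ij : 'I_n * 'I_p) := A ij.1 ij.2.
have mA' ij : measurable (A' ij) by exact: mA.
have col i : P (X i @^-1` tuple_rect (A i)) =
    (\big[*%E/1%E]_(j < p) P ((fun w => tnth (X i w) j) @^-1` A i j))%E.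
  have := entries_indep (finset (fun ij : 'I_n * 'I_p => ij.1 == i)) mA'.
  rewrite (eq_bigl (fun ij : 'I_n * 'I_p => (ij.1 == i) && true)); last first.
    by move=> ij; rewrite finset.inE andbT.
  rewrite (eq_bigr (fun ij : 'I_n * 'I_p =>
    P ((fun w => tnth (X ij.1 w) ij.2) @^-1` A ij.1 ij.2)))//.
  rewrite -(pair_big_dep (fun k => k == i) (fun _ _ => true)
    (fun k j => P ((fun w => tnth (X k w) j) @^-1` A k j)))/=.
  rewrite big_pred1_eq => <-; congr (P _); apply/seteqP; split => w /=.
    by move=> h [k j]/=; rewrite finset.inE/= => /eqP ->; exact: h.
  by move=> h j; apply: (h (i, j)); rewrite /= finset.inE.
under [RHS]eq_bigr do rewrite col.
rewrite pair_bigA/=.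
have all := entries_indep (finset xpredT) mA'.
rewrite (eq_bigl xpredT) in all; last by move=> ij; rewrite finset.inE.
rewrite -[RHS]all; congr (P _); apply/seteqP; split => w /=.
  by move=> h [k j]/= _; exact: h.
by move=> h i _ j; apply: (h (i, j)); rewrite /= finset.inE.
Qed.

(** The rectangles are replaced by general measurable sets one column at a
    time: m counts the columns already replaced. *)
Lemma columns_independent (B : 'I_n -> set (p.-tuple R)) :
  (forall i, measurable (B i)) ->
  P (\bigcap_(i in [set: 'I_n]) (X i @^-1` B i)) =
  (\big[*%E/1%E]_(i < n) P (X i @^-1` B i))%E.
Proof.
suff H m : (m <= n)%N -> forall B : 'I_n -> set (p.-tuple R),
    (forall i, measurable (B i)) ->
    (forall i : 'I_n, (m <= i)%N -> exists A : 'I_p -> set R,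
       (forall j, measurable (A j)) /\ B i = tuple_rect A) ->
    P (\bigcap_(i in [set: 'I_n]) (X i @^-1` B i)) =
    (\big[*%E/1%E]_(i < n) P (X i @^-1` B i))%E.
  by move=> mB; apply: (H n) => // i; rewrite leqNgt ltn_ord.
elim: m => [_ {}B mB rB|m IH mn {}B mB rB].
  have {rB} rB i : {A : 'I_p -> set R |
      (forall j, measurable (A j)) /\ B i = tuple_rect A}.
    by apply: cid; exact: rB.
  have BE i : B i = tuple_rect (sval (rB i)) by have [] := svalP (rB i).
  rewrite (_ : \bigcap_(i in _) _ =
    \bigcap_(i in [set: 'I_n]) (X i @^-1` tuple_rect (sval (rB i)))).
    rewrite rect_columns_independent; last first.
      by move=> i; have [] := svalP (rB i).
    by apply: eq_bigr => i _; rewrite -BE.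
  by apply: eq_bigcapr => i _; rewrite -BE.
pose i0 := Ordinal mn.
pose E := \bigcap_(i in [set i | i != i0]) (X i @^-1` B i).
have mXB i C : measurable C -> measurable (X i @^-1` C).
  by move=> mC; rewrite -[X in measurable X]setTI; exact: measurable_funPT.
have mE : measurable E.
  by apply: fin_bigcap_measurable => [|i _]; [exact: finite_finset|exact: mXB].
pose upd C i := if i == i0 then C else B i.
have cap C : \bigcap_(i in [set: 'I_n]) (X i @^-1` upd C i) = E `&` X i0 @^-1` C.
  apply/seteqP; split => w /=.
    move=> h; split; last by have := h i0 I; rewrite /upd eqxx.
    by move=> i /= /negbTE ii0; have := h i I; rewrite /upd ii0.
  move=> [Ew Cw] i _; rewrite /upd; case: eqVneq => [->//|ii0]; exact: Ew.
have prodE C : (\big[*%E/1%E]_(i < n) P (X i @^-1` upd C i) =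
    P (X i0 @^-1` C) * \big[*%E/1%E]_(i < n | i != i0) P (X i @^-1` B i))%E.
  rewrite (bigD1 i0)//= /upd eqxx; congr (_ * _)%E.
  by apply: eq_bigr => i /negbTE ->.
pose c := fine (\big[*%E/1%E]_(i < n | i != i0) P (X i @^-1` B i))%E.
have [cfin c0] : (c%:E = \big[*%E/1%E]_(i < n | i != i0) P (X i @^-1` B i))%E
    /\ 0 <= c.
  rewrite /c; elim/big_ind : _ => /=; first by split.
    move=> x y [<- x0] [<- y0]; rewrite -EFinM /=; split=> //.
    by rewrite mulr_ge0.
  by move=> i _; rewrite fineK ?fin_num_measure ?fine_ge0//; exact: mXB.
have BE : B = upd (B i0).
  by apply/funext => i; rewrite /upd; case: eqVneq => // ->.
rewrite {1}BE (_ : \big[_/_]_(i < n) _ =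
  (\big[*%E/1%E]_(i < n) P (X i @^-1` upd (B i0) i))%E); last first.
  by apply: eq_bigr => i _; rewrite -BE.
rewrite cap prodE -cfin muleC.
apply: extend_product_rule => // A mA.
rewrite -cap cfin muleC -prodE; apply: IH => //.
- exact: ltnW.
- by move=> i; rewrite /upd; case: ifP => _ //; exact: measurable_tuple_rect.
- move=> i mi; rewrite /upd; case: eqVneq => [_|ii0]; first by exists A.
  by apply: rB; rewrite ltn_neqAle mi andbT eq_sym.
Qed.

End column_independence.

(** * Lower tail of the number of hits of a set *)

Section lower_tail.
Context {R : realType} {d : measure_display} {T : measurableType d}.
Context (P : probability T R).

Lemma finite_union_bound (I : finType) (Q : pred I) (A : I -> set T) :
  (forall i, measurable (A i)) ->
  (P (\bigcup_(i in [set i | Q i]) A i) <= \sum_(i | Q i) P (A i))%E.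
Proof.
move=> mA.
have -> : \bigcup_(i in [set i | Q i]) A i = \big[setU/set0]_(i | Q i) A i.
  rewrite -bigcup_seq_cond; congr bigcup.
  by apply/seteqP; split => i /=; rewrite mem_index_enum.
pose K (B : set T) (x : \bar R) := measurable B /\ (P B <= x)%E.
suff [] : K (\big[setU/set0]_(i | Q i) A i) (\sum_(i | Q i) P (A i))%E by [].
elim/big_ind2 : _ => [|B x C y [mB Bx] [mC Cy]|i _].
- by split => //; rewrite measure0.
- split; first exact: measurableU.
  by apply: le_trans (leeD Bx Cy); exact: measureU2.
- by split.
Qed.

Context {d' : measure_display} {U : measurableType d'} {n : nat}.
Variable Y : 'I_n -> {RV P >-> U}.
Hypothesis Y_indep : forall B : 'I_n -> set U, (forall i, measurable (B i)) ->
  P (\bigcap_(i in [set: 'I_n]) (Y i @^-1` B i)) =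
  (\big[*%E/1%E]_(i < n) P (Y i @^-1` B i))%E.

Definition hits (B : set U) (w : T) : {set 'I_n} :=
  finset (fun i => `[< B (Y i w) >]).

Lemma hitsE (B : set U) (S : {set 'I_n}) :
  hits B @^-1` [set S] =
  \bigcap_(i in [set: 'I_n]) (Y i @^-1` (if i \in S then B else ~` B)).
Proof.
apply/seteqP; split => w /=.
  by move=> <- i _ /=; rewrite finset.inE; case: ifPn => /asboolP.
move=> h; apply/setP => i; rewrite finset.inE; have /= := h i I.
by case: ifPn => _ ?; [apply/asboolP|apply/negbTE/asboolPn].
Qed.

Lemma measurable_hits (B : set U) (Q : pred {set 'I_n}) : measurable B ->
  measurable [set w | Q (hits B w)].
Proof.
move=> mB.
rewrite (_ : [set w | _] = \bigcup_(S in [set S | Q S]) hits B @^-1` [set S]).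
  apply: fin_bigcup_measurable => [|S _]; first exact: finite_finset.
  rewrite hitsE; apply: fin_bigcap_measurable => [|i _]; first exact: finite_finset.
  rewrite -[X in measurable X]setTI; apply: measurable_funPT => //.
  by case: ifP => _ //; exact: measurableC.
by apply/seteqP; split => w /=; [exists (hits B w)|case=> S /= QS ->].
Qed.

(** The number of hits is binomial with parameters n and q.  Weighting each
    hit pattern S with #|S| <= v by exp(v - #|S|) >= 1 and summing the product formula over
    all S gives exp(v) (q/e + 1 - q)^n, and q/e + 1 - q <= exp(- q/2). *)
Lemma hits_lower_tail (B : set U) (q v : R) : (0 < n)%N -> measurable B ->
  (forall i, P (Y i @^-1` B) = q%:E) ->
  (P [set w | (#|hits B w|%:R <= v)%R] <= (expR (v - q * n%:R / 2))%:E)%E.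
Proof.
move=> n0 mB Bq.
have mY i C : measurable C -> measurable (Y i @^-1` C).
  by move=> mC; rewrite -[X in measurable X]setTI; exact: measurable_funPT.
have BqC i : P (Y i @^-1` (~` B)) = (1 - q)%:E.
  by rewrite preimage_setC probability_setC ?Bq//; exact: mY.
have PS (S : {set 'I_n}) : P (hits B @^-1` [set S]) =
    (\prod_(i < n) if i \in S then q else 1 - q)%:E.
  rewrite hitsE Y_indep; last by move=> i; case: ifP => _ //; exact: measurableC.
  rewrite -prodEFin; apply: eq_bigr => i _.
  by case: ifP => _; [rewrite Bq|rewrite BqC].
pose i0 := Ordinal n0.
have q0 : 0 <= q by rewrite -lee_fin -(Bq i0) measure_ge0.
have q1 : q <= 1 by rewrite -lee_fin -(Bq i0) probability_le1//; exact: mY.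
have e2 : expR (- 1) <= 2^-1 :> R.
  rewrite expRN lef_pV2 ?posrE ?expR_gt0//.
  by have := expR_ge1Dx (1 : R).
rewrite (_ : [set w | _] =
  \bigcup_(S in [set S : {set 'I_n} | (#|S|%:R <= v)%R]) hits B @^-1` [set S]);
  last first.
  by apply/seteqP; split => w /=; [exists (hits B w)|case=> S /= QS ->].
apply: le_trans (finite_union_bound _ _) _ => [S|].
  rewrite (_ : _ @^-1` _ = [set w | pred1 S (hits B w)]).
    exact: measurable_hits.
  by apply/seteqP; split => w /= /eqP.
under eq_bigr do rewrite PS.
rewrite sumEFin lee_fin.
apply: (@le_trans _ _ (\sum_(S : {set 'I_n}) expR v *
    \prod_(i < n) if i \in S then expR (- 1) * q else 1 - q)).
  apply: (@le_trans _ _ (\sum_(S : {set 'I_n} | #|S|%:R <= v) expR v *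
    \prod_(i < n) if i \in S then expR (- 1) * q else 1 - q)).
    apply: ler_sum => S Sv.
    have -> : \prod_(i < n) (if i \in S then expR (- 1) * q else 1 - q) =
        expR (- #|S|%:R) * \prod_(i < n) if i \in S then q else 1 - q.
      rewrite -(mulrN1 #|S|%:R) expRM_natl -prodr_const.
      rewrite [X in _ = X * _]big_mkcond/= -big_split/=; apply: eq_bigr => i _.
      by case: ifP => _ //; rewrite mul1r.
    rewrite mulrA ler_peMl//.
      by apply: prodr_ge0 => i _; case: ifP; rewrite ?subr_ge0.
    by rewrite -expRD -[leLHS]expR0 ler_expR subr_ge0.
  rewrite [leLHS]big_mkcond/=; apply: ler_sum => S _; case: ifP => // _.
  rewrite mulr_ge0 ?expR_ge0//; apply: prodr_ge0 => i _.
  by case: ifP; rewrite ?subr_ge0// mulr_ge0 ?expR_ge0.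
rewrite -mulr_sumr -bigA_distr prodr_const card_ord expRD.
rewrite ler_wpM2l ?expR_ge0//.
apply: (@le_trans _ _ (expR (- (q / 2)) ^+ n)).
  apply: lerXn2r; rewrite ?nnegrE ?expR_ge0//.
    by rewrite addr_ge0 ?subr_ge0// mulr_ge0 ?expR_ge0.
  apply: le_trans (expR_ge1Dx _).
  have h : expR (- 1) * q <= 2^-1 * q by rewrite ler_wpM2r.
  by rewrite /=; lra.
by rewrite -expRM_natl mulrN mulrA [n%:R * q]mulrC.
Qed.

End lower_tail.

(** * Conditional probability given an independent variable *)

Section conditional_error.
Context {R : realType} {d : measure_display} {T : measurableType d}.
Context (P : probability T R).
Context {d1 d2 : measure_display} {U : measurableType d1} {V : measurableType d2}.
Variables (Z : {RV P >-> U}) (Y : {RV P >-> V}).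
Hypothesis indep : independent_rv P Y Z.

Lemma independent_pair_section (A : set (U * V)) (K : set U) :
  measurable A -> measurable K ->
  P ([set w | A (Z w, Y w)] `&` Z @^-1` K) =
  (\int[distribution P Z]_(z in K) distribution P Y (xsection A z))%E.
Proof.
move=> mA mK.
have mZY : measurable_fun [set: T] (fun w => (Z w, Y w)).
  by apply: measurable_fun_pair; exact: measurable_funPT.
pose ZY : {mfun T >-> (U * V)%type} := mfun_Sub (mem_set mZY).
have mAK : measurable (A `&` K `*` setT).
  by apply: measurableI => //; exact: measurableX.
have -> : P ([set w | A (Z w, Y w)] `&` Z @^-1` K) =
    distribution P ZY (A `&` K `*` setT).
  rewrite /distribution /pushforward; congr (P _).
  by apply/seteqP; split => w /=; [case=> ? ?|case=> ? []].
transitivity ((distribution P Z \x distribution P Y)%E (A `&` K `*` setT)).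
  apply/esym/product_measure_unique => // B C mB mC.
  rewrite /distribution /pushforward/= muleC -indep//; congr (P _).
  by apply/seteqP; split => w /=; case.
rewrite [in RHS]integral_mkcond; apply: eq_integral => z _ /=.
rewrite patchE; case: ifPn => zK.
  congr (P _); apply/seteqP; split => w /=; rewrite /xsection /= !inE.
    by case.
  by move=> Aw; split => //; split => //; rewrite inE in zK.
rewrite -[RHS](measure0 P); congr (P _); apply/seteqP; split => w //=.
by rewrite /xsection/= inE/= => -[_ [zKw _]]; move: zK; rewrite notin_setE.
Qed.

(** Freezing the conditioning variable: the law of (Z, Y) is a product measure,
    so the integral of D over an event K of Z is that of the section measures.
    For K the event that D > r while the section measure is at most r, this
    forces P(K) = 0. *)
Lemma cond_prob_version_le_section (A : set (U * V)) (D : T -> R) (r : R) :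
  measurable A ->
  cond_prob_version P Z [set w | A (Z w, Y w)] D ->
  {ae P, forall w, (distribution P Y (xsection A (Z w)) <= r%:E)%E -> D w <= r}.
Proof.
move=> mA [DZ Dint Dver].
have [r0|r0] := ltP r 0.
  apply: aeW => w h; have := le_trans (measure_ge0 (distribution P Y) _) h.
  by rewrite lee_fin leNgt r0.
have [K1 mK1 K1E] := DZ _ (measurable_itv `]r, +oo[).
rewrite setTI in K1E.
pose K2 := [set z | (distribution P Y (xsection A z) <= r%:E)%E].
have mK2 : measurable K2.
  rewrite -[K2]setTI; apply: measurable_lee => //.
  exact: (measurable_fun_xsection (distribution P Y)).
pose K := K1 `&` K2.
have mK : measurable K by exact: measurableI.
pose H := Z @^-1` K.
have mH : measurable H.
  by rewrite -[H]setTI; exact: measurable_funPT.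
have DH w : H w -> r < D w.
  move=> [Kw _]; have : (Z @^-1` K1) w by [].
  by rewrite K1E /= in_itv/= andbT.
have intD : P.-integrable H (EFin \o D) by exact: integrableS Dint.
have intr : P.-integrable H (EFin \o cst r).
  by apply: finite_measure_integrable_cst.
have PHE : distribution P Z K = P H by [].
have le0 : (\int[P]_(w in H) (D w - r)%:E <= 0)%E.
  under eq_integral do rewrite EFinB.
  rewrite (integralB mH intD intr) Dver; last by exists K => //; rewrite setTI.
  have -> : (\int[P]_(w in H) (EFin \o cst r) w = r%:E * P H)%E.
    by rewrite -(integral_cst P mH r%:E).
  rewrite sube_le0 independent_pair_section//.
  rewrite -PHE -integral_cst//; apply: ge0_le_integral => //.
  - apply: (measurable_funS measurableT) => //.
    exact: (measurable_fun_xsection (distribution P Y)).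
  - by move=> z [].
have : (\int[P]_(w in H) `|(D w - r)%:E| = 0)%E.
  apply/eqP; rewrite eq_le integral_ge0// andbT; apply: le_trans le0.
  rewrite le_eqVlt; apply/orP; left; apply/eqP; apply: eq_integral => w.
  by rewrite inE => /DH rD; rewrite gee0_abs// lee_fin subr_ge0 ltW.
move/ae_eq_integral_abs => /(_ mH) h.
have {}h : ae_eq P H (fun w => (D w - r)%:E) (cst 0%E).
  apply: h; apply/measurable_EFinP; apply: measurable_funB => //.
  by apply/measurable_EFinP; exact: measurable_int intD.
apply: filterS h => w h Kw; rewrite leNgt; apply/negP => rD.
have Hw : H w.
  split => //; suff : (Z @^-1` K1) w by [].
  by rewrite K1E /= in_itv/= andbT.
by have /= [/eqP] := h Hw; rewrite subr_eq0 gt_eqF.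
Qed.

End conditional_error.

(** * Measurability and moment tails *)

Section measurability.
Context {R : realType} {d : measure_display} {T : measurableType d}.

Lemma measurable_fun_dotp p (f g : T -> p.-tuple R) :
  measurable_fun setT f -> measurable_fun setT g ->
  measurable_fun setT (fun w => dotp (f w) (g w)).
Proof.
move=> mf mg; apply: measurable_sum => j; apply: measurable_funM.
  by move/measurable_fun_tnthP : mf; exact.
by move/measurable_fun_tnthP : mg; exact.
Qed.

Lemma measurable_fun_sg (f : T -> R) :
  measurable_fun setT f -> measurable_fun setT (fun w => Num.sg (f w)).
Proof.
move=> mf; rewrite (_ : (fun w => _) =
  (fun w => if f w == 0 then 0 else if f w < 0 then -1 else 1)); last first.
  by apply/funext => w; rewrite /Num.sg.
apply: measurable_fun_ifT => //; first exact: measurable_fun_eqr.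
by apply: measurable_fun_ifT => //; exact: measurable_fun_ltr.
Qed.

Lemma measurable_ltr_fun (f g : T -> R) :
  measurable_fun setT f -> measurable_fun setT g ->
  measurable [set w | f w < g w].
Proof.
move=> mf mg; rewrite -[X in measurable X]setTI.
exact: (measurable_fun_ltr mf mg measurableT (Y := [set true])).
Qed.

Lemma measurable_ler_fun (f g : T -> R) :
  measurable_fun setT f -> measurable_fun setT g ->
  measurable [set w | f w <= g w].
Proof.
move=> mf mg; rewrite -[X in measurable X]setTI.
exact: (measurable_fun_ler mf mg measurableT (Y := [set true])).
Qed.

Lemma measurable_neq_fun (f g : T -> R) :
  measurable_fun setT f -> measurable_fun setT g ->
  measurable [set w | f w != g w].
Proof.
move=> mf mg.
rewrite (_ : [set w | _] = setT `&` (fun w => f w == g w) @^-1` [set false]).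
  exact: (measurable_fun_eqr mf mg measurableT).
rewrite setTI; apply/seteqP; split => w /=; first by move/negbTE.
by move=> ->.
Qed.

End measurability.

Section moment_tail.
Context {R : realType} {d : measure_display} {T : measurableType d}.
Context (P : probability T R).

(** Markov's inequality for |f|^q: exceeding the q-norm by a factor e^3 has
    probability at most e^(-3q), which is p^-3 for q = log p. *)
Lemma Lnorm_tail (f : {RV P >-> R}) (q B : R) : 1 <= q -> 0 < B ->
  (Lnorm P q%:E (EFin \o f) <= B%:E)%E ->
  (P [set w | (expR 3 * B < `|f w|)%R] <= (expR (- (3 * q)))%:E)%E.
Proof.
move=> q1 B0 fB; have q0 : 0 < q by exact: lt_le_trans q1.
have eB : 0 < expR 3 * B by rewrite mulr_gt0 ?expR_gt0.
have := markov f eB (measurable_powR q) (fun _ _ => powR_ge0 _ _)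
  (ge0_ler_powR (ltW q0)).
have -> : ('E_P[(((@powR R)^~ q \o Num.norm) \o f)] =
    Lnorm P q%:E (EFin \o f) `^ q)%E.
  rewrite poweR_Lnorm ?gt_eqF// unlock; apply: eq_integral => w _ /=.
  by [].
move=> mk.
have : (expR 3 * B) `^ q != 0 by rewrite gt_eqF ?powR_gt0.
move=> nz.
have pB : 0 < B `^ q by rewrite powR_gt0.
have mS : measurable [set w | expR 3 * B < `|f w|].
  by apply: measurable_ltr_fun => //; exact: measurableT_comp.
have mS' : measurable [set w | ((expR 3 * B)%:E <= `|(f w)%:E|)%E].
  rewrite (_ : [set w | _] = [set w | expR 3 * B <= `|f w|]).
    by apply: measurable_ler_fun => //; exact: measurableT_comp.
  by apply/seteqP; split => w.
have SS : (P [set w | (expR 3 * B < `|f w|)%R] <=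
    P [set w | ((expR 3 * B)%:E <= `|(f w)%:E|)%E])%E.
  apply: le_measure; rewrite ?inE//.
  by move=> w /= /ltW; rewrite lee_fin.
apply: le_trans SS _; set S' := [set w | _] in mk mS' *.
have Lq : (Lnorm P q%:E (EFin \o f) `^ q <= (B `^ q)%:E)%E.
  rewrite -poweR_EFin; apply: gt0_ler_poweR => //; first exact: ltW.
    by rewrite in_itv/= Lnorm_ge0 leey.
  by rewrite in_itv/= lee_fin ltW//= leey.
have eBq : (expR 3 * B) `^ q = expR (3 * q) * B `^ q.
  by rewrite powRM ?expR_ge0 1?ltW// -expRM.
have := le_trans mk Lq.
rewrite eBq -(@fineK _ (P S')) ?fin_num_measure//.
rewrite -EFinM !lee_fin mulrAC mulrC -[leRHS]mulr1 ler_pM2l// => h.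
by rewrite expRN -[leRHS]mul1r ler_pdivlMr ?expR_gt0// mulrC.
Qed.

End moment_tail.

(** * Simultaneous approximation on the sample and at a fresh point *)

Section maurey_approximation.
Context {R : realType} {p m : nat}.
Local Notation draw := {ffun 'I_m -> 'I_p * bool}.

Lemma maurey_weight_ge0 (b : p.-tuple R) (k : draw) :
  0 <= \prod_(l < m) maurey_weight b (k l).
Proof. by apply: prodr_ge0 => l _; rewrite le_max lexx. Qed.

Lemma measurable_far_from (b : p.-tuple R) (t : R) (k : draw) :
  measurable [set x : p.-tuple R |
    t < `|dotp x b - dotp x (signed_basis_average k)|].
Proof.
apply: measurable_ltr_fun => //; apply: measurableT_comp => //.
by apply: measurable_funB; apply: measurable_fun_dotp.
Qed.

Lemma measurable_large_entry (M : R) :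
  measurable [set x : p.-tuple R | exists j, M < `|tnth x j|].
Proof.
rewrite (_ : [set x | _] = \bigcup_(j in [set: 'I_p]) [set x | M < `|tnth x j|]).
  apply: fin_bigcup_measurable => [|j _]; first exact: finite_finset.
  apply: measurable_ltr_fun => //; apply: measurableT_comp => //.
  exact: measurable_tnth.
by apply/seteqP; split => x /= [j]; [exists j|exists j].
Qed.

(** Exchanging the average over the draws with the integral over nu reduces
    the claim to [maurey_deviation] at each x with entries bounded by M; the
    other x contribute at most delta. *)
Lemma maurey_mean_measure (nu : probability (p.-tuple R) R)
    (b : p.-tuple R) (M t delta : R) :
  (0 < m)%N -> l1norm b = 1 -> 0 < M -> 0 <= t -> t <= 4 * M ->
  (nu [set x | exists j, (M < `|tnth x j|)%R] <= delta%:E)%E ->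
  \sum_(k : draw) (\prod_(l < m) maurey_weight b (k l)) *
    fine (nu [set x | t < `|dotp x b - dotp x (signed_basis_average k)|]) <=
  2 * expR (- (m%:R * t ^+ 2 / (32 * M ^+ 2))) + delta.
Proof.
move=> m0 b1 M0 t0 tM nuM; set e := 2 * expR _.
set W := fun k : draw => \prod_(l < m) maurey_weight b (k l).
have W0 k : 0 <= W k by exact: maurey_weight_ge0.
have W1 : \sum_k W k = 1.
  by apply: sum_prod_weights; rewrite sum_maurey_weight.
pose A (k : draw) := [set x : p.-tuple R |
  t < `|dotp x b - dotp x (signed_basis_average k)|].
have mA k : measurable (A k) by exact: measurable_far_from.
pose L := [set x : p.-tuple R | exists j, M < `|tnth x j|].
have mL : measurable L by exact: measurable_large_entry.
rewrite -lee_fin -sumEFin.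
have -> : (\sum_k (W k * fine (nu (A k)))%:E =
    \int[nu]_x \sum_k (W k)%:E * (\1_(A k) x)%:E)%E.
  rewrite ge0_integral_sum//.
  - apply: eq_bigr => k _; rewrite ge0_integralZl_EFin//.
      by rewrite integral_indic// setIT EFinM fineK ?fin_num_measure.
    exact/measurable_EFinP/measurable_indic.
  - move=> k; apply: measurable_funeM.
    exact/measurable_EFinP/measurable_indic.
  - by move=> k x _; rewrite mule_ge0// lee_fin.
apply: (@le_trans _ _ (\int[nu]_x (e%:E + (\1_L x)%:E))%E); last first.
  rewrite ge0_integralD//; last 2 first.
    - by move=> x _; rewrite lee_fin mulr_ge0 ?expR_ge0.
    - exact/measurable_EFinP/measurable_indic.
  rewrite integral_indic// setIT integral_cst//= probability_setT mule1 EFinD.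
  exact: leeD.
apply: ge0_le_integral => //.
- by move=> x _; apply: sume_ge0 => k _; rewrite mule_ge0// lee_fin.
- apply: emeasurable_sum => k; apply: measurable_funeM.
  exact/measurable_EFinP/measurable_indic.
- apply: emeasurable_funD => //; exact/measurable_EFinP/measurable_indic.
move=> x _; under eq_bigr do rewrite -EFinM.
rewrite sumEFin -EFinD lee_fin.
have [xL|xL] := pselect (L x).
  rewrite indicE mem_set//=; apply: (@le_trans _ _ 1); last first.
    by rewrite lerDr mulr_ge0 ?expR_ge0.
  rewrite -W1; apply: ler_sum => k _; rewrite -[leRHS]mulr1 ler_wpM2l//.
rewrite indicE memNset//= addr0.
have xM j : `|tnth x j| <= M.
  by rewrite leNgt; apply/negP => jM; apply: xL; exists j.
apply: le_trans (maurey_deviation m0 b1 xM M0 t0 tM).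
apply: ler_sum => k _; rewrite ler_wpM2l// indicE ler_nat.
have [xA|xA] := pselect (A k x); last by rewrite memNset.
by rewrite mem_set// xA.
Qed.

(** Probabilistic method.  The mean over the draws of the number of sample
    points approximated badly is at most n e < 1/2, and that of the normalized
    measure of the bad fresh points is at most 1/2, so for some draw their sum
    is below 1. *)
Lemma maurey_approximation n (x : 'I_n -> p.-tuple R)
    (nu : probability (p.-tuple R) R) (b : p.-tuple R) (M t delta : R) :
  (0 < m)%N -> l1norm b = 1 -> 0 < M -> 0 <= t -> t <= 4 * M ->
  (forall i j, `|tnth (x i) j| <= M) ->
  (nu [set x | exists j, (M < `|tnth x j|)%R] <= delta%:E)%E ->
  let e := 2 * expR (- (m%:R * t ^+ 2 / (32 * M ^+ 2))) in
  n%:R * e < 2^-1 ->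
  exists k : draw,
    (forall i, `|dotp (x i) b - dotp (x i) (signed_basis_average k)| <= t) /\
    (nu [set x | (t < `|dotp x b - dotp x (signed_basis_average k)|)%R]
       <= (2 * (e + delta))%:E)%E.
Proof.
move=> m0 b1 M0 t0 tM xM nuM e ne.
set W := fun k : draw => \prod_(l < m) maurey_weight b (k l).
have W0 k : 0 <= W k by exact: maurey_weight_ge0.
have W1 : \sum_k W k = 1.
  by apply: sum_prod_weights; rewrite sum_maurey_weight.
pose A (k : draw) := [set x : p.-tuple R |
  t < `|dotp x b - dotp x (signed_basis_average k)|].
have mA k : measurable (A k) by exact: measurable_far_from.
have delta0 : 0 <= delta by rewrite -lee_fin (le_trans _ nuM).
have e0 : 0 < e by rewrite mulr_gt0 ?expR_gt0.
have ed : 0 < 2 * (e + delta) by rewrite mulr_gt0// ltr_pwDl.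
apply: contrapT => nok.
(* the sum of both defects, at least 1 at each failing draw *)
have cost k : 1 <= \sum_(i < n)
    (t < `|dotp (x i) b - dotp (x i) (signed_basis_average k)|)%R%:R +
    fine (nu (A k)) / (2 * (e + delta)).
  have nu0 : 0 <= fine (nu (A k)) / (2 * (e + delta)).
    by rewrite divr_ge0 ?fine_ge0// ltW.
  have [/existsP[i ti]|/existsPn ok] := boolP [exists i : 'I_n,
    t < `|dotp (x i) b - dotp (x i) (signed_basis_average k)|].
    rewrite (bigD1 i)//= ti -addrA lerDl addr_ge0//.
    by apply: sumr_ge0 => *.
  rewrite big1 ?add0r => [|i _]; last by rewrite (negbTE (ok i)).
  rewrite ler_pdivlMr// mul1r leNgt; apply/negP => nuk; apply: nok.
  exists k; split => [i|]; first by rewrite leNgt ok.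
  by rewrite -[leLHS]fineK ?fin_num_measure// ?lee_fin ?ltW//; exact: mA.
have : 1 <= n%:R * e + 2^-1.
  rewrite -{1}W1.
  apply: (@le_trans _ _ (\sum_k (\sum_(i < n) W k *
    (t < `|dotp (x i) b - dotp (x i) (signed_basis_average k)|)%R%:R +
    W k * fine (nu (A k)) / (2 * (e + delta))))).
    apply: ler_sum => k _; rewrite -mulr_sumr -mulrA -mulrDr.
    by rewrite -[leLHS]mulr1 ler_wpM2l.
  rewrite big_split/= lerD//.
    rewrite exchange_big/= -[n in n%:R]card_ord mulr_natl -sumr_const.
    by apply: ler_sum => i _; exact: maurey_deviation.
  rewrite -mulr_suml ler_pdivrMr// mulrA mulVf// mul1r.
  exact: maurey_mean_measure.
by rewrite leNgt => /negP; apply; rewrite [ltRHS](_ : 1 = 2^-1 + 2^-1) ?ltrD2r//; lra.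
Qed.

End maurey_approximation.

(** * The sample, its largest entry and its margins *)

Section sample_variables.
Context {R : realType} {d : measure_display} {T : measurableType d}.
Context (P : probability T R) {n p : nat}.
Variables (X : 'I_n -> {RV P >-> p.-tuple R}) (O : T -> {set 'I_n}).
Variable bstar : p.-tuple R.

Lemma measurable_obs_sample :
  (forall i, measurable [set w | i \in O w]) ->
  measurable_fun setT (obs_sample X O bstar).
Proof.
move=> mO; apply/measurable_fun_tnthP => i.
rewrite (_ : _ \o _ = fun w => (obs_label X O bstar i w, X i w)); last first.
  by apply/funext => w /=; rewrite tnth_mktuple.
apply: measurable_fun_pair; last exact: measurable_funPT.
have msg : measurable_fun setT (fun w => Num.sg (dotp (X i w) bstar)).
  by apply: measurable_fun_sg; apply: measurable_fun_dotp.
apply: measurable_fun_ifT => //; last exact: measurableT_comp.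
apply: (measurable_fun_bool true) => //.
by rewrite setTI; exact: mO.
Qed.

Lemma weak_moment_entry_tail (Kw zeta : R) (x : {RV P >-> p.-tuple R}) (j : 'I_p) :
  0 < Kw -> 1 <= ln p%:R :> R -> weak_moment P Kw zeta x ->
  (P [set w | (expR 3 * Kw * ln p%:R `^ zeta < `|tnth (x w) j|)%R]
    <= (p%:R ^- 3)%:E)%E.
Proof.
move=> K0 lnp wm.
have p0 : (0 < p)%N by apply: leq_trans (ltn_ord j).
have mxj : measurable_fun setT (fun w => tnth (x w) j).
  by apply: (measurableT_comp (@measurable_tnth _ _ _ j)); exact: measurable_funPT.
pose f : {RV P >-> R} := mfun_Sub (mem_set mxj).
have q0 : 0 < ln p%:R :> R by exact: lt_le_trans lnp.
have := @Lnorm_tail _ _ _ P f (ln p%:R) (Kw * ln p%:R `^ zeta) lnp.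
rewrite mulr_gt0 ?powR_gt0// => /(_ isT); rewrite mulrA.
have -> : expR (- (3 * ln p%:R)) = p%:R ^- 3 :> R.
  by rewrite expRN expRM_natl lnK// posrE ltr0n.
apply; have [_ /(_ (ln p%:R))] := wm j; apply.
by rewrite lnp le_max lexx orbT.
Qed.

Lemma weak_moment_large_entry (Kw zeta : R) (x : {RV P >-> p.-tuple R}) :
  0 < Kw -> 1 <= ln p%:R :> R -> weak_moment P Kw zeta x ->
  (P (x @^-1` [set v | exists j, (expR 3 * Kw * ln p%:R `^ zeta < `|tnth v j|)%R])
    <= (p%:R ^- 2)%:E)%E.
Proof.
move=> K0 lnp wm; set M := _ * _.
have mS j : measurable [set w | M < `|tnth (x w) j|].
  apply: measurable_ltr_fun => //; apply: measurableT_comp => //.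
  by apply: (measurableT_comp (@measurable_tnth _ _ _ j)); exact: measurable_funPT.
rewrite (_ : _ @^-1` _ = \bigcup_(j in [set j | xpredT j]) [set w | M < `|tnth (x w) j|]);
  last first.
  by apply/seteqP; split => w /=; [case=> j jM; exists j|case=> j _ jM; exists j].
apply: le_trans (finite_union_bound _ _ mS) _.
apply: (@le_trans _ _ (\sum_(j < p) (p%:R ^- 3 : R)%:E)%E).
  by apply: lee_sum => j _; exact: weak_moment_entry_tail.
rewrite sumEFin lee_fin sumr_const card_ord -mulr_natl.
have [->|p0] := posnP p; first by rewrite mul0r invr_ge0 exprn_ge0.
have pn0 : p%:R != 0 :> R by rewrite pnatr_eq0 -lt0n.
by rewrite le_eqVlt; apply/orP; left; apply/eqP; field.
Qed.

End sample_variables.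

Section l1_geometry.
Context {R : realType} {p : nat}.
Implicit Types x b : p.-tuple R.

Definition l1_normalize b : p.-tuple R := [tuple tnth b j / l1norm b | j < p].

Lemma l1norm_gt0 b : b != vec0 -> 0 < l1norm b.
Proof.
move=> b0; rewrite lt_neqAle sumr_ge0 // andbT eq_sym.
apply: contra b0; rewrite psumr_eq0 // => /allP b0.
apply/eqP/eq_from_tnth => j; rewrite tnth_mktuple; apply/eqP.
by have := b0 j; rewrite mem_index_enum => /(_ isT); rewrite normr_eq0.
Qed.

Lemma l1norm_normalize b : b != vec0 -> l1norm (l1_normalize b) = 1.
Proof.
move=> /l1norm_gt0 b0; rewrite /l1norm.
under eq_bigr do rewrite tnth_mktuple normrM normfV (gtr0_norm b0).
by rewrite -mulr_suml mulfV// gt_eqF.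
Qed.

Lemma dotp_normalize x b : dotp x (l1_normalize b) = dotp x b / l1norm b.
Proof. by rewrite /dotp mulr_suml; apply: eq_bigr => j _; rewrite tnth_mktuple mulrA. Qed.

Lemma dotp_le_l1 x b (M : R) : (forall j, `|tnth x j| <= M) ->
  `|dotp x b| <= M * l1norm b.
Proof.
move=> xM; rewrite mulr_sumr; apply: le_trans (ler_norm_sum _ _ _) _.
by apply: ler_sum => j _; rewrite normrM ler_wpM2r.
Qed.

Lemma l1_margin_le n (z : n.-tuple (R * p.-tuple R)) b (i : 'I_n) :
  l1_margin z b <= (tnth z i).1 * dotp (tnth z i).2 b / l1norm b.
Proof.
apply: ge_inf; last by exists i.
pose F (i : 'I_n) := (tnth z i).1 * dotp (tnth z i).2 b / l1norm b.
exists (- \sum_i `|F i|) => _ [j _ <-]; rewrite -/(F j) lerNl.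
rewrite (bigD1 j)//= (le_trans (ler_norm _))// normrN lerDl.
by apply: sumr_ge0.
Qed.

End l1_geometry.

(** * Choice of the number of draws *)

Section numerics.
Context {R : realType}.

Lemma ln_nat_ge_half (n : nat) : (2 <= n)%N -> 2^-1 <= ln n%:R :> R.
Proof.
move=> n2; have n0 : 0 < n%:R :> R by rewrite ltr0n (leq_trans _ n2).
have nV : 0 < n%:R^-1 :> R by rewrite invr_gt0.
have := @le_ln1Dx R (n%:R^-1 - 1).
rewrite (_ : 1 + (n%:R^-1 - 1) = n%:R^-1); last by lra.
rewrite lnV ?posrE// ltrBrDr addNr nV => /(_ isT).
have : n%:R^-1 <= 2^-1 :> R by rewrite lef_pV2 ?posrE// ler_nat.
lra.
Qed.

(** With m ~ 4 * 800 M^2 log(n) / gamma0^2 draws, the deviation gamma0/5 has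
    probability at most n^-4.  Since M is of order log(p)^zeta, m log p is of
    order rate n; the summand 8 absorbs the rounding of m, because
    gamma0 <= 2 M and log n >= 1/2 bound 1 by 8 M^2 log(n) / gamma0^2. *)
Lemma maurey_sample_size (n p : nat) (zeta A gamma0 : R) :
  (2 <= n)%N -> 1 <= ln p%:R :> R -> 0 < A -> 0 < gamma0 ->
  let M := A * ln p%:R `^ zeta in
  let rate := ln p%:R `^ (2 * zeta + 1) * ln n%:R / (gamma0 ^+ 2 * n%:R) in
  gamma0 <= 2 * M ->
  n%:R^-1 <= 8 * A ^+ 2 * rate /\
  exists2 m : nat, (0 < m)%N &
    m%:R * ln p%:R <= (4 * (32 * 5 ^+ 2) + 8) * A ^+ 2 * (rate * n%:R) /\
    expR (- (m%:R * (gamma0 / 5) ^+ 2 / (32 * M ^+ 2))) <= n%:R ^- 4.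
Proof.
move=> n2 lnp A0 g0 M rate gM.
have n0 : 0 < n%:R :> R by rewrite ltr0n (leq_trans _ n2).
have lnn := ln_nat_ge_half n2.
set q := ln p%:R in lnp M rate gM *; have q0 : 0 < q by exact: lt_le_trans lnp.
set l := ln n%:R in lnn rate *; have l0 : 0 < l by lra.
pose z := q `^ zeta; have z0 : 0 < z by exact: powR_gt0.
have qz : q `^ (2 * zeta + 1) = z ^+ 2 * q.
  rewrite powRD; last by rewrite (gt_eqF q0) implybT.
  by rewrite powRr1 1?ltW// [2 * _]mulrC powRrM powR_mulrn ?powR_ge0.
have M0 : 0 < M by rewrite mulr_gt0.
have ratenE : rate * n%:R = z ^+ 2 * q * l / gamma0 ^+ 2.
  rewrite /rate qz; field; by rewrite !gt_eqF.
have M2 : 4^-1 <= M ^+ 2 / gamma0 ^+ 2.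
  rewrite ler_pdivlMr ?exprn_gt0//.
  have : gamma0 ^+ 2 <= (2 * M) ^+ 2.
    by apply: lerXn2r => //; rewrite nnegrE ltW ?mulr_gt0.
  by rewrite exprMn; lra.
have M2E : M ^+ 2 / gamma0 ^+ 2 = A ^+ 2 * (z ^+ 2 / gamma0 ^+ 2).
  by rewrite exprMn mulrA.
set r := z ^+ 2 / gamma0 ^+ 2 in M2E *.
have r0 : 0 < r by rewrite divr_gt0 ?exprn_gt0.
have rateE : rate * n%:R = r * (q * l) by rewrite ratenE /r; field; rewrite gt_eqF.
have Ar : 4^-1 <= A ^+ 2 * r by rewrite -M2E.
have Ar0 : 0 < A ^+ 2 * r by rewrite mulr_gt0 ?exprn_gt0.
split.
  rewrite -[leLHS]mul1r ler_pdivrMr//.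
  have -> : 8 * A ^+ 2 * rate * n%:R = 8 * (A ^+ 2 * r * (q * l)).
    by rewrite -mulrA rateE; ring.
  have ql : 2^-1 <= q * l.
    by rewrite -[leLHS]mul1r ler_pM// invr_ge0.
  have : 4^-1 * 2^-1 <= A ^+ 2 * r * (q * l) by rewrite ler_pM ?invr_ge0.
  by lra.
pose c : R := 4 * (32 * 5 ^+ 2); rewrite -/c.
have c0 : 0 < c by rewrite /c; lra.
have cE : 4 = c / (32 * 5 ^+ 2) by rewrite /c mulfK// mulf_neq0 ?expf_neq0.
clearbody c.
pose a := c * (A ^+ 2 * r) * l.
have a0 : 0 < a by apply: mulr_gt0 => //; exact: mulr_gt0.
have /andP[ma am] := Num.Theory.truncn_itv (ltW a0).
exists (Num.truncn a).+1 => //; split.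
  rewrite rateE.
  have m_le : (Num.truncn a).+1%:R <= (c + 8) * (A ^+ 2 * r) * l.
    rewrite -natr1; apply: le_trans (lerD ma (lexx 1)) _.
    have : 4^-1 * 2^-1 <= A ^+ 2 * r * l by rewrite ler_pM ?invr_ge0.
    by rewrite /a; lra.
  have -> : (c + 8) * A ^+ 2 * (r * (q * l)) = (c + 8) * (A ^+ 2 * r) * l * q by ring.
  by rewrite ler_wpM2r// ltW.
have -> : n%:R ^- 4 = expR (- (4 * l)) by rewrite expRN expRM_natl lnK.
rewrite ler_expR lerN2.
have -> : 4 * l = a * (gamma0 / 5) ^+ 2 / (32 * M ^+ 2).
  rewrite cE /a -M2E; field; by rewrite !gt_eqF.
apply: ler_wpM2r; first by rewrite invr_ge0 mulr_ge0 ?sqr_ge0.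
apply: ler_wpM2r; first exact: sqr_ge0.
exact: ltW.
Qed.

End numerics.

(** * Sign disagreements *)

Section bad_sets.
Context {R : realType} {p : nat}.
Implicit Types x b : p.-tuple R.

Definition small_signed_margin bstar (tau : R) b : set (p.-tuple R) :=
  [set x | Num.sg (dotp x bstar) * dotp x b <= tau].

Lemma measurable_small_signed_margin bstar tau b :
  measurable (small_signed_margin bstar tau b).
Proof.
apply: measurable_ler_fun => //; apply: measurable_funM.
  by apply: measurable_fun_sg; apply: measurable_fun_dotp.
by apply: measurable_fun_dotp.
Qed.

(** Outside both exceptional cases, the normalized b has a positive margin at
    x with respect to the sign of bstar, because b' has margin above tau and
    lies within tau of it. *)
Lemma sign_disagreement bstar (tau : R) b b' x : 0 <= tau -> b != vec0 ->
  Num.sg (dotp x b) != Num.sg (dotp x bstar) ->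
  small_signed_margin bstar tau b' x \/
  tau < `|dotp x (l1_normalize b) - dotp x b'|.
Proof.
move=> tau0 b0 sgne; apply: contrapT => /not_orP[far near].
move/eqP: sgne; apply.
move/negP: far; rewrite -ltNge => far.
move/negP: near; rewrite -leNgt dotp_normalize => near.
have N0 := l1norm_gt0 b0.
have sgE : Num.sg (dotp x b / l1norm b) = Num.sg (dotp x b).
  by rewrite sgrM sgrV (gtr0_sg N0) mulr1.
move: near; rewrite -sgE; set c := _ / _ => near.
move: near; rewrite ler_norml => /andP[n1 n2].
case: (sgrP (dotp x bstar)) far => [_|_|_]; rewrite ?mul0r ?mul1r ?mulN1r => far.
- by move: far; rewrite ltNge tau0.
- by rewrite gtr0_sg//; lra.
- by rewrite ltr0_sg//; lra.
Qed.

End bad_sets.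

(** * Generalization from the margin *)

Section uniform_lower_tail.
Context {R : realType} {d : measure_display} {T : measurableType d}.
Context (P : probability T R) {n p : nat}.
Variables (X : 'I_n -> {RV P >-> p.-tuple R}).
Hypothesis X_indep : forall B : 'I_n -> set (p.-tuple R),
  (forall i, measurable (B i)) ->
  P (\bigcap_(i in [set: 'I_n]) (X i @^-1` B i)) =
  (\big[*%E/1%E]_(i < n) P (X i @^-1` B i))%E.
Variable nu : probability (p.-tuple R) R.
Hypothesis X_nu : forall i A, measurable A -> P (X i @^-1` A) = nu A.

Lemma uniform_hits_lower_tail (I : finType) (B : I -> set (p.-tuple R)) (u : R) :
  (0 < n)%N -> (forall k, measurable (B k)) ->
  (P (\bigcup_(k in [set k | (u <= fine (nu (B k)))%R])
        [set w | (#|hits X (B k) w|%:R <= u * n%:R / 4)%R])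
   <= (#|I|%:R * expR (- (u * n%:R / 4)))%:E)%E.
Proof.
move=> n0 mB.
have mH k : measurable [set w | (#|hits X (B k) w|%:R <= u * n%:R / 4)].
  exact: (measurable_hits X (fun S : {set 'I_n} => #|S|%:R <= u * n%:R / 4)).
apply: le_trans (finite_union_bound _ _ mH) _.
apply: (@le_trans _ _ (\sum_(k : I | (u <= fine (nu (B k)))%R)
    (expR (- (u * n%:R / 4)))%:E)%E).
  apply: lee_sum => k uk.
  apply: le_trans (hits_lower_tail X_indep (q := fine (nu (B k))) _ n0 (mB k) _) _.
    by move=> i; rewrite fineK ?fin_num_measure// X_nu.
  rewrite lee_fin ler_expR.
  have : u * n%:R <= fine (nu (B k)) * n%:R by rewrite ler_wpM2r.
  lra.
rewrite sumEFin lee_fin big_mkcond/= mulr_natl -sumr_const.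
by apply: ler_sum => k _; case: ifP => // _; exact: expR_ge0.
Qed.

End uniform_lower_tail.

Lemma probability_setD_ge {R : realType} {d} {T : measurableType d}
    (P : probability T R) (E F : set T) (a b : R) :
  measurable E -> measurable F -> (a%:E <= P E)%E -> (P F <= b%:E)%E ->
  ((a - b)%:E <= P (E `\` F))%E.
Proof.
move=> mE mF aE Fb.
have mEF : measurable (E `\` F) by exact: measurableD.
rewrite EFinB leeBlDr//; apply: le_trans aE _.
apply: (@le_trans _ _ (P ((E `\` F) `|` F))).
  apply: le_measure; rewrite ?inE//; first exact: measurableU.
  by move=> x Ex; have [Fx|Fx] := pselect (F x); [right|left].
apply: le_trans (measureU2 _ mEF mF) _ => //.
exact: leeD.
Qed.

Section margin_bound.
Context {R : realType} {d : measure_display} {T : measurableType d}.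
Context (P : probability T R).

(** The margin argument, for an arbitrary level rho above the rate.  The good
    event removes three sets from the one where the margin is at least gamma0:
    large features, the failure of the uniform lower tail (each of probability
    at most 1/p), and a null set.  The constant csize bounds m log p / (rate n) for
    the number m of draws. *)
Lemma margin_generalization (n p : nat) (s zeta Kw : R) (bstar : p.-tuple R)
    (X : 'I_n -> {RV P >-> p.-tuple R}) (O : T -> {set 'I_n})
    (Xnew : {RV P >-> p.-tuple R})
    (btilde : n.-tuple (R * p.-tuple R) -> p.-tuple R)
    (D : T -> R) (t gamma0 rho : R) :
  let A := expR 3 * Kw in
  let csize := (4 * (32 * 5 ^+ 2) + 8) * A ^+ 2 in
  (2 <= n)%N -> n%:R <= p%:R :> R -> 1 <= ln p%:R :> R -> 0 < Kw ->
  one_bit_model s bstar X O Xnew ->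
  (forall i, weak_moment P Kw zeta (X i)) ->
  measurable_fun [set: n.-tuple (R * p.-tuple R)] btilde ->
  {ae P, forall w, approx_max_l1_margin (obs_sample X O bstar w)
                     (btilde (obs_sample X O bstar w))} ->
  prediction_error X O bstar Xnew btilde D ->
  0 < gamma0 ->
  with_prob_ge P (1 - t)
    [set w | gamma0 <= max_l1_margin (obs_sample X O bstar w)] ->
  ln p%:R `^ (2 * zeta + 1) * ln n%:R / (gamma0 ^+ 2 * n%:R) <= rho ->
  {ae P, forall w, #|O w|%:R <= 3 * csize * rho * n%:R} ->
  with_prob_ge P (1 - 2 / p%:R - t)
    [set w | D w <= (12 * csize + 20 * A ^+ 2) * rho].
Proof.
move=> A csize n2 np lnp Kw0 model wm mbt approx err g0 [E1 [mE1 E1g PE1]] rate_rho Oc.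
have [bsph _ mO indepE _ _ _ XnewX XnewZ] := model.
have n0 : (0 < n)%N by exact: leq_trans n2.
have nR : 0 < n%:R :> R by rewrite ltr0n.
have pR : 0 < p%:R :> R by exact: lt_le_trans np.
pose Z : {RV P >-> n.-tuple (R * p.-tuple R)} :=
  mfun_Sub (mem_set (measurable_obs_sample X bstar mO)).
pose nu := distribution P Xnew.
have X_nu i C : measurable C -> P (X i @^-1` C) = nu C.
  by move=> mC; rewrite /nu /= -(XnewX i).
have A0 : 0 < A by rewrite mulr_gt0 ?expR_gt0.
have csize0 : 0 < csize by rewrite mulr_gt0 ?exprn_gt0 ?ltr_wpDl// ?mulr_ge0 ?exprn_ge0.
pose M := A * ln p%:R `^ zeta.
have M0 : 0 < M by rewrite mulr_gt0 ?powR_gt0// (lt_le_trans _ lnp).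
pose L := [set x : p.-tuple R | exists j, M < `|tnth x j|].
have mL : measurable L by exact: measurable_large_entry.
pose LX := \bigcup_(i in [set i : 'I_n | xpredT i]) (X i @^-1` L).
have mXL i : measurable (X i @^-1` L).
  by rewrite -[X in measurable X]setTI; exact: measurable_funPT.
have mLX : measurable LX.
  by apply: fin_bigcup_measurable => [|i _]; [exact: finite_finset|exact: mXL].
have nuL : (nu L <= (p%:R ^- 2)%:E)%E.
  by rewrite -(X_nu (Ordinal n0))//; exact: weak_moment_large_entry.
have PLX : (P LX <= (p%:R^-1)%:E)%E.
  apply: le_trans (finite_union_bound _ _ mXL) _.
  apply: (@le_trans _ _ (\sum_(i < n) (p%:R ^- 2 : R)%:E)%E).
    by apply: lee_sum => i _; exact: weak_moment_large_entry.
  rewrite sumEFin lee_fin sumr_const card_ord -[leLHS]mulr_natl.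
  by rewrite ler_pdivrMr ?exprn_gt0// expr2 mulKf ?gt_eqF.
pose bound := (12 * csize + 20 * A ^+ 2) * rho.
pose W := [set u : n.-tuple (R * p.-tuple R) * p.-tuple R |
  Num.sg (dotp u.2 (btilde u.1)) != Num.sg (dotp u.2 bstar)].
have mW : measurable W.
  apply: measurable_neq_fun; apply: measurable_fun_sg; apply: measurable_fun_dotp => //.
  by apply: measurableT_comp.
have Dle := @cond_prob_version_le_section _ _ _ P _ _ _ _ Z Xnew XnewZ W D bound mW err.
have [N [mN PN0 Nsub]] : P.-negligible (~` [set w |
   [/\ approx_max_l1_margin (Z w) (btilde (Z w)),
       #|O w|%:R <= 3 * csize * rho * n%:R &
       ((nu (xsection W (Z w)) <= bound%:E)%E -> D w <= bound)]]).
  apply: filterS3 approx Oc Dle => w h1 h2 h3.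
  by split.
have {}PN0 : (P N <= 0)%E by rewrite PN0.
have {}Nsub w : ~ N w -> [/\ approx_max_l1_margin (Z w) (btilde (Z w)),
       #|O w|%:R <= 3 * csize * rho * n%:R &
       ((nu (xsection W (Z w)) <= bound%:E)%E -> D w <= bound)].
  by move=> Nw; apply: contrapT => h; apply: Nw; exact: Nsub.
have ZE w i : tnth (Z w) i = (obs_label X O bstar i w, X i w).
  by rewrite /= tnth_mktuple.
have label_le1 w i : `|obs_label X O bstar i w| <= 1.
  by rewrite /obs_label; case: ifP => _; rewrite ?normrN normr_sg; case: (_ != _).
have margin w i : E1 w -> ~ N w ->
    gamma0 / 2 <= obs_label X O bstar i w *
      dotp (X i w) (l1_normalize (btilde (Z w))).
  move=> /E1g /= gw /Nsub[[_ ap] _ _].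
  have := l1_margin_le (Z w) (btilde (Z w)) i; rewrite ZE/= => ml.
  rewrite dotp_normalize mulrA; apply: le_trans ml; apply: le_trans ap.
  by rewrite ler_wpM2r ?invr_ge0.
have notL w i j : ~ LX w -> `|tnth (X i w) j| <= M.
  by move=> Lw; rewrite leNgt; apply/negP => Mj; apply: Lw; exists i => //; exists j.
have dotpM w i : ~ LX w -> ~ N w ->
    `|dotp (X i w) (l1_normalize (btilde (Z w)))| <= M.
  move=> Lw /Nsub[[b0 _] _ _].
  have := @dotp_le_l1 R p (X i w) (l1_normalize (btilde (Z w))) M.
  by rewrite l1norm_normalize// mulr1; apply => j; exact: notL.
have g2M w : E1 w -> ~ LX w -> ~ N w -> gamma0 <= 2 * M.
  move=> E1w Lw Nw; have i0 := Ordinal n0.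
  have := margin w i0 E1w Nw; have := dotpM w i0 Lw Nw; have := label_le1 w i0.
  set y := obs_label _ _ _ _ _; set v := dotp _ _ => y1 vM gyv.
  have : y * v <= M.
    rewrite (le_trans (ler_norm _))// normrM -[leRHS]mul1r.
    by rewrite ler_pM.
  lra.
(* If gamma0 > 2 M, the margin event lies in LX up to a null set, so that the
   claimed probability is not positive. *)
have [gM|gM] := leP gamma0 (2 * M); last first.
  exists set0; split => //.
  have : ((1 - t - p%:R^-1)%:E <= P (E1 `\` (LX `|` N)))%E.
    apply: probability_setD_ge => //; first exact: measurableU.
    apply: le_trans (measureU2 _ mLX mN) _.
    by rewrite -[leRHS]adde0; exact: leeD.
  rewrite (_ : E1 `\` (LX `|` N) = set0).
    rewrite !measure0 !lee_fin.
    have : 0 < p%:R^-1 :> R by rewrite invr_gt0.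
    lra.
  apply/seteqP; split => w //= -[E1w /not_orP[Lw Nw]].
  by have := g2M w E1w Lw Nw; rewrite leNgt gM.
have [rate_n [m m0 [m_csize em]]] := maurey_sample_size n2 lnp A0 g0 gM.
rewrite -/M in em.
have n4 : n%:R ^- 4 <= 8^-1 * n%:R^-1 :> R.
  rewrite -invfM lef_pV2 ?posrE ?mulr_gt0 ?exprn_gt0// exprSr ler_pM2r//.
  by rewrite -natrX ler_nat -[8%N]/(2 ^ 3)%N leq_exp2r.
have {}em := le_trans em n4.
set rate := _ / _ in rate_n m_csize rate_rho.
(* any tau with tau < gamma0/2 - tau would do *)
pose tau := gamma0 / 5.
pose I := {ffun 'I_m -> 'I_p * bool}.
pose B (k : I) := small_signed_margin bstar tau (signed_basis_average k).
have mB k : measurable (B k) by exact: measurable_small_signed_margin.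
(* u n / 4 = 3 csize rho n is both the allowed number of flips and at least
   log((2p)^m p). *)
pose u := 12 * csize * rho.
pose Cl := \bigcup_(k in [set k | (u <= fine (nu (B k)))%R])
   [set w | (#|hits X (B k) w|%:R <= u * n%:R / 4)%R].
have mCl : measurable Cl.
  apply: fin_bigcup_measurable => [|k _]; first exact: finite_finset.
  exact: (measurable_hits X (fun S : {set 'I_n} => #|S|%:R <= u * n%:R / 4)).
have PCl : (P Cl <= (p%:R^-1)%:E)%E.
  apply: le_trans (uniform_hits_lower_tail (columns_independent indepE) X_nu u n0 mB) _.
  rewrite lee_fin card_ffun card_prod !card_ord card_bool natrX natrM.
  set q := ln p%:R in lnp m_csize.
  have pE : p%:R = expR q by rewrite lnK.
  have p2 : p%:R * 2 <= expR (2 * q).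
    rewrite mulrC expRM_natl -pE expr2 ler_pM2r// pE.
    by apply: le_trans (expR_ge1Dx q); lra.
  apply: (@le_trans _ _ (expR (2 * q) ^+ m * expR (- (u * n%:R / 4)))).
    apply: ler_wpM2r; first exact: expR_ge0.
    by apply: lerXn2r; rewrite ?nnegrE ?expR_ge0// mulr_ge0// ltW.
  (* the exponents: m log(2p) + log p <= 3 m log p, and m log p <= csize rho n *)
  rewrite -expRM_natl -expRD pE -expRN ler_expR.
  have rn : csize * (rate * n%:R) <= csize * (rho * n%:R).
    by rewrite ler_pM2l// ler_pM2r.
  have -> : u * n%:R / 4 = 3 * (csize * (rho * n%:R)) by rewrite /u; field.
  have qm : q <= m%:R * q.
    by rewrite -[leLHS]mul1r ler_wpM2r ?ler1n// (le_trans _ lnp).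
  have : m%:R * q <= csize * (rho * n%:R) by apply: le_trans rn.
  clear -qm; move: (csize * _) => c; move: (m%:R * q) (mulrCA m%:R 2 q) qm => mq -> qm mc.
  lra.
exists (E1 `\` (LX `|` Cl `|` N)); split.
- by apply: measurableD => //; apply: measurableU => //; exact: measurableU.
- move=> w [E1w /not_orP[/not_orP[Lw Clw] Nw]].
  have [[b0 _] Ow] := Nsub w Nw; apply.
  pose b := l1_normalize (btilde (Z w)).
  have b1 : l1norm b = 1 by rewrite l1norm_normalize.
  have tau0 : 0 <= tau by rewrite divr_ge0// ltW.
  have tauM : tau <= 4 * M by rewrite /tau; lra.
  have [|k [kX kfar]] := maurey_approximation m0 b1 M0 tau0 tauM
    (fun i j => notL w i j Lw) nuL.
    have := ler_wpM2l (ltW nR) em.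
    have -> : n%:R * (8^-1 * n%:R^-1) = 8^-1 :> R by field; rewrite gt_eqF.
    by rewrite -/tau [n%:R * (2 * _)]mulrCA; lra.
  have hitsO : hits X (B k) w \subset O w.
    apply/fintype.subsetP => i; rewrite finset.inE => /asboolP Bk.
    apply: contraLR Bk => iO; rewrite -ltNge.
    have := margin w i E1w Nw; have := kX i; have := label_le1 w i.
    rewrite /obs_label (negbTE iO) -/b.
    set y := Num.sg _; set v := dotp _ b; set v' := dotp _ _ => y1 vv yv.
    have : y * (v - v') <= tau.
      rewrite (le_trans (ler_norm _))// normrM -[leRHS]mul1r.
      by apply: ler_pM.
    by rewrite mulrBr /tau; lra.
  have Bku : fine (nu (B k)) < u.
    rewrite ltNge; apply/negP => uB; apply: Clw; exists k => //=.
    apply: le_trans (_ : #|O w|%:R <= _); first by rewrite ler_nat subset_leq_card.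
    apply: le_trans Ow _; rewrite le_eqVlt; apply/orP; left; apply/eqP.
    by rewrite /u; field.
  pose far := [set x : p.-tuple R |
    tau < `|dotp x b - dotp x (signed_basis_average k)|].
  have mfar : measurable far by exact: measurable_far_from.
  apply: (@le_trans _ _ (nu (B k) + nu far)%E).
    apply: le_trans (measureU2 _ (mB k) mfar).
    apply: le_measure; rewrite ?inE.
    - exact: measurable_xsection.
    - exact: measurableU.
    move=> x; rewrite /xsection/= inE => /(sign_disagreement _ tau0 b0).
    exact.
  apply: le_trans (leeD2l _ kfar) _.
  rewrite -(@fineK _ (nu (B k))) ?fin_num_measure// -EFinD lee_fin.
  (* the fresh deviation: 2 (1/(4n) + 1/p^2) <= 5/(2n) <= 20 A^2 rate *)
  have pn : p%:R ^- 2 <= n%:R^-1 :> R.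
    rewrite lef_pV2 ?posrE ?exprn_gt0//; apply: (le_trans np).
    rewrite expr2; apply: ler_peMr; first exact: ltW.
    by apply: le_trans np; rewrite ler1n.
  have Arate : A ^+ 2 * rate <= A ^+ 2 * rho by rewrite ler_pM2l ?exprn_gt0.
  have -> : bound = u + 20 * (A ^+ 2 * rho).
    by rewrite /bound /u; ring.
  move: rate_n; rewrite -[8 * _ * _]mulrA => rate_n.
  move: em; rewrite -/tau; lra.
rewrite (_ : 1 - 2 / p%:R - t = 1 - t - (p%:R^-1 + p%:R^-1)); last by lra.
apply: probability_setD_ge => //.
  by apply: measurableU => //; exact: measurableU.
apply: le_trans (measureU2 _ _ mN) _; first exact: measurableU.
rewrite -[leRHS]adde0; apply: leeD => //.
by rewrite EFinD; apply: le_trans (measureU2 _ mLX mCl) _; exact: leeD.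
Qed.

End margin_bound.

(** * The rates *)

Section rates.
Context {R : realType}.

Lemma eta_rate_gt0 (zeta alpha gamma0 : R) (n p : nat) :
  (2 <= n)%N -> 1 <= ln p%:R :> R -> 0 < gamma0 ->
  0 < eta_rate zeta alpha gamma0 n p.
Proof.
move=> n2 lnp g0; have lnn := @ln_nat_ge_half R n n2.
apply: powR_gt0; apply: divr_gt0.
  by apply: mulr_gt0; [apply: powR_gt0; lra|lra].
by rewrite mulr_gt0 ?exprn_gt0// ltr0n (leq_trans _ n2).
Qed.

Lemma eta_rate_powE (zeta alpha gamma0 : R) (n p : nat) :
  (2 <= n)%N -> 1 <= ln p%:R :> R -> 0 < gamma0 -> 0 < alpha ->
  eta_rate zeta alpha gamma0 n p `^ (2 + alpha) =
  ln p%:R `^ (2 * zeta + 1) * ln n%:R / (gamma0 ^+ 2 * n%:R).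
Proof.
move=> n2 lnp g0 a0; have lnn := @ln_nat_ge_half R n n2.
rewrite /eta_rate -powRrM mul1r mulVf ?powRr1//; last by rewrite gt_eqF// addr_gt0.
apply: divr_ge0; last by rewrite mulr_ge0 ?sqr_ge0.
by rewrite mulr_ge0 ?powR_ge0//; lra.
Qed.

Lemma rate_le_eta_pow (zeta alpha gamma0 e : R) (n p : nat) :
  (2 <= n)%N -> 1 <= ln p%:R :> R -> 0 < gamma0 -> 0 < alpha ->
  eta_rate zeta alpha gamma0 n p <= 1 -> e <= 2 + alpha ->
  ln p%:R `^ (2 * zeta + 1) * ln n%:R / (gamma0 ^+ 2 * n%:R) <=
  eta_rate zeta alpha gamma0 n p `^ e.
Proof.
move=> n2 lnp g0 a0 eta1 ea; rewrite -(@eta_rate_powE zeta alpha)//.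
by rewrite ger_powR// eta1 eta_rate_gt0.
Qed.

Lemma dimension_large (C0 : R) (n p : nat) :
  (2 <= n)%N -> expR 1 <= C0 -> C0 * n%:R <= p%:R ->
  n%:R <= p%:R :> R /\ 1 <= ln p%:R :> R.
Proof.
move=> n2 C0e np; have n1 : 1 <= n%:R :> R by rewrite ler1n (leq_trans _ n2).
have e1 : 1 <= expR 1 :> R by rewrite -[leLHS]expR0 ler_expR.
have C01 : 1 <= C0 by exact: le_trans C0e.
have np' : n%:R <= p%:R :> R by apply: le_trans np; rewrite ler_peMl// ltW.
split => //.
have p0 : 0 < p%:R :> R by apply: lt_le_trans np'; exact: lt_le_trans n1.
rewrite -ler_expR lnK ?posrE//; apply: le_trans np; apply: le_trans C0e _.
by rewrite ler_peMr// (le_trans _ C01).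
Qed.

(** At the smallest admissible level 1/p the two assumptions give
    Ks p^-theta <= P(|<x, b>| <= 1/p) <= Ka p^-alpha. *)
Lemma small_deviation_dimension {d : measure_display} {T : measurableType d}
    (P : probability T R) (p : nat) (x : T -> p.-tuple R) (b : p.-tuple R)
    (Ka alpha Ks theta : R) :
  (0 < p)%N -> 0 < Ks -> theta < alpha -> unit_sphere b ->
  anti_concentration P Ka alpha x -> small_deviation P Ks theta x ->
  p%:R <= (Ka / Ks) `^ (alpha - theta)^-1.
Proof.
move=> p0 Ks0 ta bs ac sd.
have pR : 0 < p%:R :> R by rewrite ltr0n.
have peps : (p%:R^-1 : R) <= (p%:R^-1 : R) <= 1.
  by apply/andP; split => //; rewrite -[leRHS]invr1 lef_pV2 ?posrE// ler1n.
have : ((Ks * p%:R^-1 `^ theta)%:E <= (Ka * p%:R^-1 `^ alpha)%:E)%E.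
  apply: (@le_trans _ _ (P [set w | (`|dotp (x w) b| <= p%:R^-1)%R])).
    by apply: le_trans (sd _ peps) _; apply: ereal_inf_lbound; exists b.
  by apply: le_trans (ac _ peps); apply: ereal_sup_ubound; exists b.
have pV e : p%:R^-1 `^ e = p%:R `^ (- e) :> R.
  by rewrite -(powR_inv1 (ltW pR)) -powRrM mulN1r.
rewrite !pV lee_fin => h.
have pd : p%:R `^ (alpha - theta) <= Ka / Ks.
  rewrite ler_pdivlMr// mulrC powRD; last by rewrite (gt_eqF pR) implybT.
  have pa : 0 < p%:R `^ alpha :> R by rewrite powR_gt0.
  have aN : p%:R `^ alpha * p%:R `^ (- alpha) = 1 :> R.
    by rewrite powRN mulfV// gt_eqF.
  have := ler_wpM2l (ltW pa) h.
  by rewrite [X in _ <= X]mulrCA aN mulr1 mulrCA.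
have d0 : 0 < alpha - theta by rewrite subr_gt0.
have -> : p%:R = (p%:R `^ (alpha - theta)) `^ (alpha - theta)^-1 :> R.
  by rewrite -powRrM mulfV ?gt_eqF// powRr1// ltW.
apply: ge0_ler_powR => //; rewrite ?nnegrE ?powR_ge0 ?invr_ge0 ?(ltW d0)//.
by apply: le_trans pd; rewrite powR_ge0.
Qed.

End rates.

Theorem theorem2p1 (R : realType) (zeta alpha Kw Ka : R)
    (zeta_ge : 2^-1 <= zeta) (alpha_itv : 0 < alpha <= 1)
    (Kw_gt0 : 0 < Kw) (Ka_gt0 : 0 < Ka) :
  (exists C0 c1 c2 C c : R,
    [/\ 0 < C0, 0 < c1, 0 < c2, 0 < C & 0 < c] /\
    forall (d : measure_display) (T : measurableType d) (P : probability T R)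
      (n p : nat) (s : R) (bstar : p.-tuple R)
      (X : 'I_n -> {RV P >-> p.-tuple R}) (O : T -> {set 'I_n})
      (Xnew : {RV P >-> p.-tuple R})
      (btilde : n.-tuple (R * p.-tuple R) -> p.-tuple R)
      (D : T -> R) (t gamma0 : R),
    (2 <= n)%N ->
    C0 * n%:R <= p%:R ->
    one_bit_model s bstar X O Xnew ->
    (forall i, weak_moment P Kw zeta (X i)) ->
    (forall i, anti_concentration P Ka alpha (X i)) ->
    measurable_fun [set: n.-tuple (R * p.-tuple R)] btilde ->
    {ae P, forall w, approx_max_l1_margin (obs_sample X O bstar w)
                       (btilde (obs_sample X O bstar w))} ->
    prediction_error X O bstar Xnew btilde D ->
    0 < gamma0 ->
    with_prob_ge P (1 - t)
      [set w | gamma0 <= max_l1_margin (obs_sample X O bstar w)] ->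
    eta_rate zeta alpha gamma0 n p <= c1 ->
    {ae P, forall w,
      #|O w|%:R <= c2 * eta_rate zeta alpha gamma0 n p `^ alpha * n%:R} ->
    with_prob_ge P (1 - c / p%:R - t)
      [set w | D w <= C * eta_rate zeta alpha gamma0 n p `^ alpha])
  /\
  (forall theta Ks : R, 0 < theta -> 0 < Ks ->
   exists C0 c1 c2 C c : R,
    [/\ 0 < C0, 0 < c1, 0 < c2, 0 < C & 0 < c] /\
    forall (d : measure_display) (T : measurableType d) (P : probability T R)
      (n p : nat) (s : R) (bstar : p.-tuple R)
      (X : 'I_n -> {RV P >-> p.-tuple R}) (O : T -> {set 'I_n})
      (Xnew : {RV P >-> p.-tuple R})
      (btilde : n.-tuple (R * p.-tuple R) -> p.-tuple R)
      (D : T -> R) (t gamma0 : R),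
    (2 <= n)%N ->
    C0 * n%:R <= p%:R ->
    one_bit_model s bstar X O Xnew ->
    (forall i, weak_moment P Kw zeta (X i)) ->
    (forall i, anti_concentration P Ka alpha (X i)) ->
    (forall i, small_deviation P Ks theta (X i)) ->
    measurable_fun [set: n.-tuple (R * p.-tuple R)] btilde ->
    {ae P, forall w, approx_max_l1_margin (obs_sample X O bstar w)
                       (btilde (obs_sample X O bstar w))} ->
    prediction_error X O bstar Xnew btilde D ->
    0 < gamma0 ->
    with_prob_ge P (1 - t)
      [set w | gamma0 <= max_l1_margin (obs_sample X O bstar w)] ->
    eta_rate zeta alpha gamma0 n p <= c1 ->
    {ae P, forall w,
      #|O w|%:R <= c2 * eta_rate zeta alpha gamma0 n p `^ (alpha * (1 + 2 / theta))
                   * n%:R} ->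
    with_prob_ge P (1 - c / p%:R - t)
      [set w | D w <= C * eta_rate zeta alpha gamma0 n p
                          `^ (alpha * (1 + 2 / theta))]).
Proof.
pose A := expR 3 * Kw.
pose csize := (4 * (32 * 5 ^+ 2) + 8) * A ^+ 2.
have A0 : 0 < A by rewrite mulr_gt0 ?expR_gt0.
have csize0 : 0 < csize by rewrite mulr_gt0 ?exprn_gt0 ?ltr_wpDl// ?mulr_ge0 ?exprn_ge0.
have CC0 : 0 < 12 * csize + 20 * A ^+ 2 by rewrite addr_gt0// mulr_gt0 ?exprn_gt0.
have /andP[alpha0 alpha1] := alpha_itv.
split=> [|theta Ks theta0 Ks0].
  exists (expR 1), 1, (3 * csize), (12 * csize + 20 * A ^+ 2), 2.
  split; first by split; rewrite ?expR_gt0 ?mulr_gt0.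
  move=> d T P n p s bstar X O Xnew btilde D t gamma0.
  move=> n2 np model wm _ mbt approx err g0 E1g eta1 Oc.
  have [np' lnp] := dimension_large n2 (lexx _) np.
  apply: (margin_generalization n2 np' lnp Kw_gt0 model wm mbt approx err g0 E1g _ Oc).
  by apply: rate_le_eta_pow => //; lra.
pose Cd := (Ka / Ks) `^ (alpha - theta)^-1.
have Cd0 : 0 <= Cd by exact: powR_ge0.
exists (expR 1 + Cd), 1, (3 * csize), (12 * csize + 20 * A ^+ 2), 2.
split; first by split; rewrite ?mulr_gt0// ltr_pwDl ?expR_gt0.
move=> d T P n p s bstar X O Xnew btilde D t gamma0.
move=> n2 np model wm ac sd mbt approx err g0 E1g eta1 Oc.
have [np' lnp] : n%:R <= p%:R :> R /\ 1 <= ln p%:R :> R.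
  by apply: dimension_large np => //; rewrite lerDl.
have i0 : 'I_n := Ordinal (ltnW n2).
(* theta < alpha would bound p by Cd, which is below C0 *)
have [theta_lt|theta_ge] := ltP theta alpha.
  have p0 : (0 < p)%N by rewrite -(ltr0n R) (lt_le_trans _ np')// ltr0n ltnW.
  have [bsph _ _ _ _ _ _ _ _] := model.
  have := small_deviation_dimension p0 Ks0 theta_lt bsph (ac i0) (sd i0).
  rewrite -/Cd leNgt => /negP[]; apply: lt_le_trans np.
  apply: (@lt_le_trans _ _ (expR 1 + Cd)); first by rewrite ltrDr expR_gt0.
  by rewrite ler_peMr ?ler1n ?(ltnW n2)// addr_ge0 ?expR_ge0.
apply: (margin_generalization n2 np' lnp Kw_gt0 model wm mbt approx err g0 E1g _ Oc).
apply: rate_le_eta_pow => //; rewrite mulrDr mulr1 addrC lerD2r.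
by rewrite mulrCA ler_piMr// ler_pdivrMr// mul1r.
Qed.
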